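(* Let $p$ be an odd prime and $G$ the extraspecial group described below. Then there is a natural bijection $\Omega_{\mathrm{Ch}}(G)\cong U$, given by $f\mapsto(\alpha,u)$ with $\alpha=f|_{V^*}$ and $u=f(\phi(\zeta))$. Under this bijection the map $\kappa\colon\Omega(G)\to\Omega_{\mathrm{Ch}}(G)$ is injective, and its image is the set of pairs $(\alpha,u)\in U$ such that the image of the dual map $\alpha^*\colon\Theta^*\to V$ is an isotropic subspace of $V$.
   Context: Let $V$ be an elementary Abelian $p$-group of rank $2d$ with a nondegenerate alternating form $b\colon V\times V\to\mathbb F_p$; a subspace $W$ is isotropic if $b(u,w)=0$ for all $u,w\in W$. Let $G=\mathbb F_p\times V$ with $(x,u)(y,w)=(x+y+b(u,w),u+w)$; it is a central extension $Z=\mathbb F_p\to G\xrightarrow{q}V$. Put $V^*=\mathrm{Hom}(V,S^1)$, so $R(V)=\mathbb Z[V^*]\subset R(G)$ via $q$. Let $\zeta\colon Z\to S^1$ be $x\mapsto e^{2\pi ix/p}$ and $\phi(\zeta)$ the irreducible character of $G$ equal to $p^d\zeta(g)$ on $g\in Z$ and $0$ off $Z$. Let $\Theta=(\mathbb Q_p/\mathbb Z_p)^n$ ($n\ge1$), $\Theta^*=\mathrm{Hom}(\Theta,\mathbb Q_p/\mathbb Z_p)=\mathbb Z_p^n$, $\Theta(1)$ the $p$-torsion of $\Theta$. $\mathbb N[\Theta]\subset\mathbb Z[\Theta]$ are the group semiring/ring, with $\lambda^k([a_1]+\dots+[a_m])=\sum_{i_1<\dots<i_k}[a_{i_1}+\dots+a_{i_k}]$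 and Adams operation $\psi^k[a]=[ka]$; $\mathbb Z[\Theta]^+_m$ denotes the elements $[a_1]+\dots+[a_m]$ of $\mathbb N[\Theta]$. $\Omega(G)$ is the set of conjugacy classes of homomorphisms $\Theta^*\to G$; $\Omega_{\mathrm{Ch}}(G)$ is the set of $\Lambda$-ring homomorphisms $R(G)\to\mathbb Z[\Theta]$ sending honest representations into $\mathbb N[\Theta]$; $\kappa$ sends $[\mu]$ to $\mu^*$ (restriction along $\mu$, viewing $\mathbb Z[\Theta]$ as virtual continuous representations of $\Theta^*$). For a homomorphism $\alpha\colon V^*\to\Theta$ put $c_\alpha=\sum_{\chi\in V^*}[\alpha(\chi)]$ and $U_\alpha=\{u\in\mathbb Z[\Theta(1)]^+_{p^d}: u\,\psi^{p-1}(u)=c_\alpha\}$, and $U=\{(\alpha,u): u\in U_\alpha\}$. The dual $\alpha^*\colon\Theta^*\to V$ is obtained by identifying $\mathrm{Hom}(V^*,\Theta)$ with $\mathrm{Hom}(\Theta^*,V^{**})=\mathrm{Hom}(\Theta^*,V)$. *)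

(* Defs.v *)
From HB Require Import structures.
From mathcomp Require Import all_boot all_order all_algebra all_fingroup.
From mathcomp Require Import all_solvable all_field all_character.
From mathcomp Require Import freeg.
From mathcomp Require Import ring.

Set Implicit Arguments.
Unset Strict Implicit.
Unset Printing Implicit Defensive.

Import GRing.Theory Num.Theory.
Local Open Scope ring_scope.

Definition bform (p d : nat) (A : 'M['F_p]_(d.*2)) (u w : 'rV['F_p]_(d.*2))
  : 'F_p := (u *m A *m w^T) 0 0.

Section Heis.
Variables (p d : nat) (A : 'M['F_p]_(d.*2)).

Local Notation b := (bform A).

Lemma bformDl u w z : b (u + w) z = b u z + b w z.
Proof. by rewrite /bform !mulmxDl mxE. Qed.

Lemma bformDr u w z : b u (w + z) = b u w + b u z.
Proof. by rewrite /bform linearD /= mulmxDr mxE. Qed.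

Lemma bformNl u z : b (- u) z = - b u z.
Proof. by rewrite /bform !mulNmx mxE. Qed.

Lemma bform0l z : b 0 z = 0.
Proof. by rewrite /bform !mul0mx mxE. Qed.

(* the carrier of G (it is tagged with A, on which the group law depends) *)
Definition heis_of (A' : 'M['F_p]_(d.*2)) : Type := ('F_p * 'rV['F_p]_(d.*2))%type.
Local Notation heis := (heis_of A).
HB.instance Definition _ := Finite.on heis.

Definition heis_mul (x y : heis) : heis := (x.1 + y.1 + b x.2 y.2, x.2 + y.2).
Definition heis_one : heis := (0, 0).
Definition heis_inv (x : heis) : heis := (- x.1 + b x.2 x.2, - x.2).

Lemma heis_mulA : associative heis_mul.
Proof.
move=> [x1 x2] [y1 y2] [z1 z2]; rewrite /heis_mul /=.
rewrite bformDl bformDr; congr (_, _); last by rewrite addrA.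
ring.
Qed.

Lemma heis_mul1 : left_id heis_one heis_mul.
Proof. by move=> [x1 x2]; rewrite /heis_mul /= bform0l !add0r addr0. Qed.

Lemma heis_mulV : left_inverse heis_one heis_inv heis_mul.
Proof.
move=> [x1 x2]; rewrite /heis_mul /heis_one /= bformNl; congr (_, _); [ring | exact: addNr].
Qed.

HB.instance Definition _ := Finite_isGroup.Build heis heis_mulA heis_mul1 heis_mulV.

Definition heisZ : {set heis} := [set g : heis | g.2 == 0].
Definition heis_lift (v : 'rV['F_p]_(d.*2)) : heis := (0, v).

Lemma heis_conj2 (x y : heis) : (x ^ y)%g.2 = x.2.
Proof.
rewrite /conjg; case: x y => [x1 x2] [y1 y2].
by rewrite /= /heis_mul /heis_inv /= addrC addrK.
Qed.

Lemma heis_conj1 (x y : heis) : x.2 = 0 -> (x ^ y)%g.1 = x.1.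
Proof.
rewrite /conjg; case: x y => [x1 x2] [y1 y2] /= ->.
rewrite /= /heis_mul /heis_inv /= add0r bform0l bformNl; ring.
Qed.

End Heis.

(* e^{2 pi i m/N} = (e^{i pi / N})^(2m); N.-root (-1) is e^{i pi/N} (the N-th *)
(* root of -1 of minimal nonnegative argument).                              *)
Definition expi (m N : nat) : algC := (N.-root (-1)) ^+ (2 * m).

Definition zeta (p : nat) (x : 'F_p) : algC := expi (x : nat) p.

Definition phi_fun (p d : nat) (A : 'M['F_p]_(d.*2)) (g : heis_of A) : algC :=
  if g.2 == 0 then (p ^ d)%:R * zeta g.1 else 0.

Lemma phi_class (p d : nat) (A : 'M['F_p]_(d.*2)) :
  is_class_fun (generated [set: heis_of A]) [ffun g => phi_fun g].
Proof.
apply: intro_class_fun => [x y _ _ | x]; last first.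
  by rewrite (subsetP (subset_gen _)) ?inE.
rewrite /phi_fun heis_conj2; case: eqP => // /eqP/eqP h.
by rewrite heis_conj1.
Qed.

Definition phi_zeta (p d : nat) (A : 'M['F_p]_(d.*2)) : 'CF([set: heis_of A]) :=
  Cfun 0 (phi_class A).

(*    lambda^k chi (g) = e_k(eigenvalues of g), computed from the power    *)
(*    sums chi(g^i) by Newton's identities                                 *)
(*      k e_k = sum_{i=1}^k (-1)^(i-1) p_i e_(k-i).                        *)

Fixpoint newton_seq (pw : nat -> algC) (k : nat) : seq algC :=
  if k is k'.+1 then
    let s := newton_seq pw k' in
    rcons s (k%:R^-1 * \sum_(i < k) (-1) ^+ i * pw i.+1 * nth 0 s (k' - i))
  else [:: 1].

Definition elem_of_pw (pw : nat -> algC) (k : nat) : algC :=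
  nth 0 (newton_seq pw k) k.

Lemma eq_newton_seq pw1 pw2 k : pw1 =1 pw2 -> newton_seq pw1 k = newton_seq pw2 k.
Proof.
move=> E; elim: k => //= k ->; congr rcons; congr (_ * _).
by apply: eq_bigr => i _; rewrite E.
Qed.

Section Lambda.
Variable gT : finGroupType.

Lemma lam_class (k : nat) (chi : 'CF([set: gT])) :
  is_class_fun (generated [set: gT])
    [ffun x : gT => elem_of_pw (fun i => chi (x ^+ i)%g) k].
Proof.
apply: intro_class_fun => [x y _ Gy | x]; last first.
  by rewrite (subsetP (subset_gen _)) ?inE.
rewrite /elem_of_pw (@eq_newton_seq _ (fun i => chi (x ^+ i)%g)) //.
by move=> i /=; rewrite -conjXg cfunJgen.
Qed.

Definition cflam (k : nat) (chi : 'CF([set: gT])) : 'CF([set: gT]) :=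
  Cfun 0 (lam_class k chi).

End Lambda.

(* 4. Q_p/Z_p (= Z[1/p]/Z, elements normalised in [0,1)), Theta and Z[Theta] *)

Definition pfrac (p : nat) (q : rat) : bool :=
  [&& 0 <= q, q < 1 & (p.-nat `|denq q|)%N].

Definition QZp (p : nat) := {q : rat | pfrac p q}.

Lemma pfrac0 p : pfrac p 0.
Proof. by rewrite /pfrac. Qed.

Definition qz0 (p : nat) : QZp p := exist _ 0 (pfrac0 p).

Definition fracq (q : rat) : rat := q - (Num.floor q)%:~R.

Definition qzadd (p : nat) (x y : QZp p) : QZp p :=
  insubd (qz0 p) (fracq (val x + val y)).

Definition qzexp (p : nat) (x : QZp p) : algC :=
  expi `|numq (val x)|%N `|denq (val x)|%N.

Definition Theta (n p : nat) := {ffun 'I_n -> QZp p}.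

Definition th0 (n p : nat) : Theta n p := [ffun _ => qz0 p].
Definition thadd (n p : nat) (a b : Theta n p) : Theta n p :=
  [ffun i => qzadd (a i) (b i)].
Definition thnat (n p : nat) (k : nat) (a : Theta n p) : Theta n p :=
  iter k (thadd a) (th0 n p).
Definition th_tors (n p : nat) (a : Theta n p) : bool := thnat p a == th0 n p.

Definition is_dual (n p : nat) (th : Theta n p -> QZp p) : Prop :=
  forall a b, th (thadd a b) = qzadd (th a) (th b).
Definition dual_add (n p : nat) (th th' : Theta n p -> QZp p) : Theta n p -> QZp p :=
  fun a => qzadd (th a) (th' a).

Definition ZTh (n p : nat) := {freeg (Theta n p) / int}.

Definition zdelta (n p : nat) (a : Theta n p) : ZTh n p := [freeg [:: (1%:Z, a)]].
Definition zscal (n p : nat) (z : int) (a : Theta n p) : ZTh n p := [freeg [:: (z, a)]].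

Definition zone (n p : nat) : ZTh n p := zdelta (th0 n p).
Definition zmul (n p : nat) (x y : ZTh n p) : ZTh n p :=
  \sum_(a <- dom x) \sum_(b <- dom y) zscal (coeff a x * coeff b y) (thadd a b).
Definition zpsi (n p : nat) (k : nat) (x : ZTh n p) : ZTh n p :=
  \sum_(a <- dom x) zscal (coeff a x) (thnat k a).
Definition zN (n p : nat) (x : ZTh n p) : bool := all (fun a => 0 <= coeff a x) (dom x).
(* x = [a_1] + ... + [a_m] : the list a_1, ..., a_m (x in N[Theta]) *)
Definition zexpand (n p : nat) (x : ZTh n p) : seq (Theta n p) :=
  flatten [seq nseq `|coeff a x|%N a | a <- dom x].
Definition zlam_seq (n p : nat) (k : nat) (s : seq (Theta n p)) : ZTh n p :=
  \sum_(I : {set 'I_(size s)} | #|I| == k)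
     zdelta (\big[@thadd n p/th0 n p]_(i in I) nth (th0 n p) s i).
Definition zlam (n p : nat) (k : nat) (x : ZTh n p) : ZTh n p :=
  zlam_seq k (zexpand x).
(* the character on Theta^* of the virtual representation x of Theta^* :  *)
(*   [a] is the character th |-> e^{2 pi i th(a)}                         *)
Definition zchar (n p : nat) (x : ZTh n p) (th : Theta n p -> QZp p) : algC :=
  \sum_(a <- dom x) (coeff a x)%:~R * qzexp (th a).

Section Objects.
Variables (n p d : nat) (A : 'M['F_p]_(d.*2)).
Local Notation G := [set: heis_of A].
Local Notation Th := (Theta n p).
Local Notation ZT := (ZTh n p).

(* V^* = Hom(V, S^1), viewed inside R(G) via q : the linear characters of *)
(* G whose kernel contains Z                                              *)
Definition Vstar : pred (Iirr G) :=
  [pred i | ('chi_i \is a linear_char) && (heisZ A \subset cfker 'chi_i)].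

(* Omega_Ch(G): Lambda-ring homomorphisms R(G) = Z[irr G] -> Z[Theta]     *)
(* sending honest representations (characters) into N[Theta].  (f is     *)
(* only relevant on Z[irr G].)                                           *)
Definition OmegaCh (f : 'CF(G) -> ZT) : Prop :=
  [/\ {in 'Z[irr G]%g &, forall x y, f (x + y) = f x + f y},
      {in 'Z[irr G]%g &, forall x y, f (x * y) = zmul (f x) (f y)},
      f 1 = zone n p,
      (forall chi, chi \is a character -> zN (f chi)) &
      (forall chi k, chi \is a character -> f (cflam k chi) = zlam k (f chi))].

Definition hom_Vstar (alpha : Iirr G -> Th) : Prop :=
  forall i j k, i \in Vstar -> j \in Vstar -> k \in Vstar ->
    'chi_k = 'chi_i * 'chi_j -> alpha k = thadd (alpha i) (alpha j).

Definition c_alpha (alpha : Iirr G -> Th) : ZT := \sum_(i in Vstar) zdelta (alpha i).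

Definition in_U (alpha : Iirr G -> Th) (u : ZT) : Prop :=
  [/\ hom_Vstar alpha,
      zN u, deg u = (p ^ d)%:Z, all (@th_tors n p) (dom u) &
      zmul u (zpsi p.-1 u) = c_alpha alpha].

Definition restr (f : 'CF(G) -> ZT) (alpha : Iirr G -> Th) (u : ZT) : Prop :=
  (forall i, i \in Vstar -> f 'chi_i = zdelta (alpha i)) /\ u = f (phi_zeta A).

Definition hom_dual (mu : (Th -> QZp p) -> heis_of A) : Prop :=
  forall th th', is_dual th -> is_dual th' ->
    mu (dual_add th th') = (mu th * mu th')%g.

Definition conj_hom (mu mu' : (Th -> QZp p) -> heis_of A) : Prop :=
  exists g : heis_of A, forall th, is_dual th -> mu' th = (mu th ^ g)%g.

(* kappa[mu] = mu^* : restriction along mu, Z[Theta] viewed as virtual    *)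
(* representations of Theta^*                                           *)
Definition is_kappa (mu : (Th -> QZp p) -> heis_of A) (f : 'CF(G) -> ZT) : Prop :=
  forall x, x \in 'Z[irr G]%g -> forall th, is_dual th -> zchar (f x) th = x (mu th).

(* image of the dual map alpha^* : Theta^* -> V** = V *)
Definition in_img_dual (alpha : Iirr G -> Th) (v : 'rV['F_p]_(d.*2)) : Prop :=
  exists th, is_dual th /\
    forall i, i \in Vstar -> 'chi_i (heis_lift A v) = qzexp (th (alpha i)).

Definition img_dual_isotropic (alpha : Iirr G -> Th) : Prop :=
  forall v w, in_img_dual alpha v -> in_img_dual alpha w -> bform A v w = 0.

End Objects.

(* Main.v *)
(* An element of Z[Theta] is determined by its values [zchar x th] at the duals [th], so everything is
   checked pointwise.  For an f in Omega_Ch(G) with restriction alpha, the relation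
   phi(zeta)^p = p^(d(p-2)) (sum of V^* ) shows that u = f(phi(zeta)) has value 0 at th unless
   th o alpha is trivial, in which case all terms of u take the same value at th, a p-th root of unity;
   the lambda-operation of degree p then forces u to be p-torsion.  Conversely, for (alpha, u) in U
   the relation u psi^(p-1)(u) = c_alpha gives the same dichotomy.  Hence, fixing a term [a0] of u and
   sending th to (x, alpha^* th) with zeta x = e^(2 pi i th(a0)), every character of G is evaluated at
   a point of G attached to th, compatibly with multiples of th, and f is recovered from these points.
   This map Theta^* -> G is a homomorphism exactly when alpha^* has isotropic image. *)

Require Import Defs.
From HB Require Import structures.
From mathcomp Require Import all_boot all_order all_algebra all_fingroup.
From mathcomp Require Import all_solvable all_field all_character.
From mathcomp Require Import freeg.
From mathcomp Require Import ring lra.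
From Stdlib Require Import FunctionalExtensionality ClassicalEpsilon.

Import GRing.Theory Num.Theory.
Local Open Scope ring_scope.
Import Order.TTheory.

Set Implicit Arguments.
Unset Strict Implicit.
Unset Printing Implicit Defensive.


(** * Roots of -1 of minimal argument *)

Lemma sin_subr_gt0 (R : realFieldType) (c s c' s' : R) :
  c ^+ 2 + s ^+ 2 = 1 -> c' ^+ 2 + s' ^+ 2 = 1 -> 0 <= s -> 0 < s' -> c < c' ->
  0 < s * c' - c * s'.
Proof.
move=> e e' s0 s0' cc'; rewrite subr_gt0.
have [c0|c0] := ltP c 0; last first.
  have : s' < s by nra.
  nra.
have [c0'|c0'] := leP 0 c'; first by nra.
have : s < s' by nra.
nra.
Qed.

Lemma sin_subr_ge0 (R : realFieldType) (c s c' s' : R) :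
  c ^+ 2 + s ^+ 2 = 1 -> c' ^+ 2 + s' ^+ 2 = 1 -> 0 <= s -> 0 <= s' -> c <= c' ->
  0 <= s * c' - c * s'.
Proof.
move=> e e' s0 s0' cc'; rewrite subr_ge0.
have [c0|c0] := ltP c 0; last first.
  have : s' <= s by nra.
  nra.
have [c0'|c0'] := leP 0 c'; first by nra.
have : s <= s' by nra.
nra.
Qed.

Lemma Im_conjM (x y : algC) : 'Im (x * y^*) = 'Im x * 'Re y - 'Re x * 'Im y.
Proof. by rewrite ImM Re_conj Im_conj; ring. Qed.

Lemma Im_conjM_gt0 (x y : algC) : `|x| = 1 -> `|y| = 1 -> 0 <= 'Im x -> 0 < 'Im y ->
  'Re x < 'Re y -> 0 < 'Im (x * y^*).
Proof.
move=> x1 y1; rewrite Im_conjM.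
move: (normC2_Re_Im x) (normC2_Re_Im y); rewrite x1 y1 expr1n.
pose a := in_algR (Creal_Re x); pose b := in_algR (Creal_Im x).
pose c := in_algR (Creal_Re y); pose d := in_algR (Creal_Im y) => e1 e2.
have E1 : a ^+ 2 + b ^+ 2 = 1 by apply: val_inj; rewrite /= -e1.
have E2 : c ^+ 2 + d ^+ 2 = 1 by apply: val_inj; rewrite /= -e2.
by move=> h1 h2 h3; have := @sin_subr_gt0 _ a b c d E1 E2 h1 h2 h3.
Qed.

Lemma Im_conjM_ge0 (x y : algC) : `|x| = 1 -> `|y| = 1 -> 0 <= 'Im x -> 0 <= 'Im y ->
  'Re x <= 'Re y -> 0 <= 'Im (x * y^*).
Proof.
move=> x1 y1; rewrite Im_conjM.
move: (normC2_Re_Im x) (normC2_Re_Im y); rewrite x1 y1 expr1n.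
pose a := in_algR (Creal_Re x); pose b := in_algR (Creal_Im x).
pose c := in_algR (Creal_Re y); pose d := in_algR (Creal_Im y) => e1 e2.
have E1 : a ^+ 2 + b ^+ 2 = 1 by apply: val_inj; rewrite /= -e1.
have E2 : c ^+ 2 + d ^+ 2 = 1 by apply: val_inj; rewrite /= -e2.
by move=> h1 h2 h3; have := @sin_subr_ge0 _ a b c d E1 E2 h1 h2 h3.
Qed.

Lemma unit_upper_inj (x y : algC) : `|x| = 1 -> `|y| = 1 -> 0 <= 'Im x -> 0 <= 'Im y ->
  'Re x = 'Re y -> x = y.
Proof.
move=> x1 y1 ix iy e; move: (normC2_Re_Im x); rewrite x1 -y1 normC2_Re_Im e.
move/addrI/eqP; rewrite eqrXn2 // => /eqP e'.
by rewrite [x]Crect [y]Crect e e'.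
Qed.

Lemma eq1N1 : (1 == -1 :> algC) = false.
Proof. by rewrite -subr_eq0 opprK -[1 + 1]/(2%:R) pnatr_eq0. Qed.

Section OddRoot.
Variables (K : nat) (w : algC).
Hypotheses (oK : odd K) (K1 : (1 < K)%N) (defw : w = K.-root (-1)).

Lemma oddroot_exp : w ^+ K = -1.
Proof. by rewrite defw rootCK // ltnW. Qed.

Lemma oddroot_norm (x : algC) : x ^+ K = -1 -> `|x| = 1.
Proof.
move=> e; apply/eqP; rewrite -(pexpr_eq1 (ltnW K1) (normr_ge0 x)).
by rewrite -normrX e normrN1.
Qed.

Lemma oddroot_Re (x : algC) : x ^+ K = -1 -> 0 <= 'Im x -> 'Re x <= 'Re w.
Proof. by move=> e i; rewrite defw; apply: rootC_Re_max => //; apply: ltnW. Qed.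

Lemma oddroot_Im : 0 < 'Im w.
Proof.
have w1 := oddroot_norm oddroot_exp.
have i0 : 0 <= 'Im w by rewrite defw Im_rootC_ge0.
rewrite lt_neqAle i0 andbT; apply/eqP => i1.
have wr : w \is Creal by apply/Creal_ImP.
have wN1 : w = -1.
  have := normC2_Re_Im w; rewrite w1 -i1 (Creal_ReP _ wr) expr0n addr0 expr1n => /esym/eqP.
  rewrite sqrf_eq1 => /orP[] /eqP // we; move: oddroot_exp.
  by rewrite we expr1n => /eqP; rewrite eq1N1.
have all1 (t : algC) : t ^+ K = -1 -> 0 <= 'Im t -> t = -1.
  move=> tK ti; apply: unit_upper_inj => //; first exact: oddroot_norm.
  - by rewrite normrN1.
  - by rewrite -wN1.
  apply/eqP; rewrite eq_le -{1}wN1 oddroot_Re //=.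
  rewrite raddfN /= (Creal_ReP _ _) ?rpred1 // real_lerNnormlW ?Creal_Re //.
  by rewrite -(oddroot_norm tK) leif_normC_Re_Creal.
have [z zp] := C_prim_root_exists (ltnW K1).
have zK : (- z) ^+ K = -1 by rewrite exprNn -signr_odd oK (prim_expr_order zp) expr1 mulr1.
have zN1 : - z = -1.
  have [zi|zi] := real_leP (real0 algC) (Creal_Im (- z)); first exact: all1.
  apply: (inv_inj conjCK); rewrite rmorphN1; apply: all1.
    by rewrite -rmorphXn zK rmorphN1.
  by rewrite Im_conj oppr_ge0 ltW.
have := prim_order_dvd zp 1; rewrite (oppr_inj zN1) expr1n eqxx dvdn1.
by move=> /eqP k1; move: K1; rewrite k1.
Qed.

Lemma oddroot_neq0 : w != 0.
Proof. by rewrite -normr_eq0 (oddroot_norm oddroot_exp) oner_eq0. Qed.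

Lemma oddroot_conj : w^* = w^-1.
Proof. by rewrite invC_norm (oddroot_norm oddroot_exp) expr1n invr1 mul1r. Qed.

(* Rotating by [w^-2] decreases the argument by [2 pi / K]; the result stays in the upper half *)
(* plane because its conjugate would otherwise beat the maximality of ['Re w].                 *)
Lemma oddroot_descent (x : algC) : x ^+ K = -1 -> 0 <= 'Im x -> x != w ->
  [/\ (x * w ^- 2) ^+ K = -1, 0 <= 'Im (x * w ^- 2) & 'Re x < 'Re (x * w ^- 2)].
Proof.
move=> xK xi xw; have w1 := oddroot_norm oddroot_exp; have x1 := oddroot_norm xK.
have wi := oddroot_Im.
have xK' : (x * w ^- 2) ^+ K = -1.
  by rewrite exprMn xK -exprVn -exprM mulnC exprM exprVn oddroot_exp invrN1 sqrrN expr1n mulr1.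
have x1' := oddroot_norm xK'.
have re : 'Re x < 'Re w.
  rewrite lt_neqAle oddroot_Re // andbT; apply: contraNneq xw => e.
  by apply/eqP/unit_upper_inj => //; apply: ltW.
have yi := Im_conjM_gt0 x1 w1 xi wi re.
have xE : x * w ^- 2 = x * w^* * w^* by rewrite oddroot_conj -mulrA -expr2 exprVn.
have incr : 'Re x < 'Re (x * w ^- 2).
  rewrite -subr_gt0 xE.
  have -> : 'Re (x * w^* * w^*) - 'Re x = 2 * ('Im (x * w^*) * 'Im w).
    have {2}-> : x = x * w^* * w by rewrite oddroot_conj mulfVK ?oddroot_neq0.
    by rewrite ReM [X in _ - X]ReM Re_conj Im_conj; ring.
  by rewrite mulr_gt0 ?ltr0n // mulr_gt0.
split=> //; have [//|neg] := real_leP (real0 algC) (Creal_Im (x * w ^- 2)).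
set t := (x * w ^- 2)^*.
have tK : t ^+ K = -1 by rewrite -rmorphXn xK' rmorphN1.
have ti : 0 <= 'Im t by rewrite Im_conj oppr_ge0 ltW.
have := Im_conjM_ge0 (oddroot_norm tK) w1 ti (ltW wi) (oddroot_Re tK ti).
have -> : t * w^* = (x * w^*)^*.
  by rewrite /t xE -rmorphM mulrAC [w^*]oddroot_conj mulfVK ?oddroot_neq0.
by rewrite Im_conj oppr_ge0 => /(lt_le_trans yi); rewrite ltxx.
Qed.

Lemma oddroot_chain (x : algC) : x ^+ K = -1 -> 0 <= 'Im x ->
  exists2 j, x = w ^+ j.*2.+1 &
    forall i, (i <= j)%N -> 0 <= 'Im (w ^+ i.*2.+1) /\ 'Re x <= 'Re (w ^+ i.*2.+1).
Proof.
pose y x i := x * w ^- i.*2.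
move=> xK xi.
have step m : (exists2 j, (j <= m)%N & x = w ^+ j.*2.+1 /\
      forall i, (i <= j)%N -> 0 <= 'Im (w ^+ i.*2.+1) /\ 'Re x <= 'Re (w ^+ i.*2.+1))
    \/ (forall i, (i <= m)%N -> [/\ y x i ^+ K = -1, 0 <= 'Im (y x i), 'Re x <= 'Re (y x i)
         & (0 < i)%N -> 'Re x < 'Re (y x i)]).
  elim: m => [|m IHm].
    by right=> i; rewrite leqn0 => /eqP->; rewrite /y expr0 invr1 mulr1.
  case: IHm => [[j jm jP]|IHm]; first by left; exists j => //; apply: leqW.
  have [e|ne] := eqVneq (y x m) w.
    left; exists m => //.
    have w0 := oddroot_neq0.
    have xE : x = w ^+ m.*2.+1 by rewrite exprS -{1}e /y mulfVK ?expf_neq0.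
    split=> // i im; have := IHm (m - i)%N (leq_subr _ _); rewrite /y {1 2 4}xE.
    have -> : w ^+ m.*2.+1 * w ^- (m - i).*2 = w ^+ i.*2.+1.
      by rewrite -{1}(subnKC im) doubleD -addSn exprD mulfK ?expf_neq0.
    by case.
  right=> i; rewrite leq_eqVlt ltnS => /orP[/eqP->|/IHm//].
  have [yK yi yr _] := IHm m (leqnn m).
  have yS : y x m.+1 = y x m * w ^- 2.
    by rewrite /y doubleS -addn2 exprD invfM mulrA.
  have [h1 h2 h3] := oddroot_descent yK yi ne.
  by rewrite yS; split=> //; [apply: ltW|move=> _]; apply: le_lt_trans h3.
case: (step K) => [[j _ [xE jP]]|/(_ K (leqnn K)) [_ _ _ /(_ (ltnW K1))]]; first by exists j.
by rewrite /y -muln2 exprM oddroot_exp sqrrN expr1n invr1 mulr1 ltxx.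
Qed.

Lemma oddroot_prim : (K.*2).-primitive_root w.
Proof.
have w2K : w ^+ K.*2 = 1 by rewrite -muln2 exprM oddroot_exp sqrrN expr1n.
have K2 : (0 < K.*2)%N by rewrite double_gt0 ltnW.
have [m mp mK] := prim_order_exists K2 w2K.
have Km : (K %| m)%N.
  have [z zp] := C_prim_root_exists (ltnW K1).
  have zK : (- z) ^+ K = -1 by rewrite exprNn -signr_odd oK (prim_expr_order zp) expr1 mulr1.
  have [j e] : exists j, z = - w ^+ j \/ z^* = - w ^+ j.
    have [zi|zi] := real_leP (real0 algC) (Creal_Im (- z)).
      by have [j e _] := oddroot_chain zK zi; exists j.*2.+1; left; rewrite -e opprK.
    have zK' : (- z)^* ^+ K = -1 by rewrite -rmorphXn zK rmorphN1.
    have [|j e _] := oddroot_chain zK'; first by rewrite Im_conj oppr_ge0 ltW.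
    by exists j.*2.+1; right; rewrite -e rmorphN opprK.
  have wm j' : (- w ^+ j') ^+ (2 * m) = 1.
    by rewrite exprM sqrrN -!exprM ?mulnA mulnC exprM (prim_expr_order mp) expr1n.
  suff : (K %| 2 * m)%N by rewrite Gauss_dvdr // coprimen2.
  rewrite (prim_order_dvd zp); case: e => e; first by rewrite e wm.
  by rewrite -[z]conjCK e -rmorphXn wm rmorph1.
have [c mE] := dvdnP Km.
move: mK; rewrite mE -mul2n dvdn_pmul2r; last exact: ltnW.
move=> /dvdn_leq => /(_ isT); case: c mE => [|[|[|c]]] // mE _.
- by move: (prim_order_gt0 mp); rewrite mE.
- by move: (prim_expr_order mp); rewrite mE mul1n oddroot_exp => /eqP; rewrite eq_sym eq1N1.
- by move: mp; rewrite mE mul2n.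
Qed.
End OddRoot.

Lemma rootN1_tower (M N : nat) : odd M -> odd N -> ((M * N).-root (-1) : algC) ^+ M = N.-root (-1).
Proof.
move=> oM oN; have [K1|K1] := leqP (M * N) 1.
  have MN : ((M * N) == 1)%N by rewrite eqn_leq K1 muln_gt0 !odd_gt0.
  by move: MN; rewrite muln_eq1 => /andP[/eqP-> /eqP->]; rewrite mul1n expr1.
have oK : odd (M * N) by rewrite oddM oM.
set w := (M * N).-root (-1); have defw : w = (M * N).-root (-1) by [].
have wp := oddroot_prim oK K1 defw; have wK := oddroot_exp K1 defw.
have [N1|N1] := leqP N 1.
  have NE : N = 1%N by apply/eqP; rewrite eqn_leq N1 odd_gt0.
  by rewrite NE root1C /w NE muln1 rootCK // odd_gt0.
set v := N.-root (-1); have defv : v = N.-root (-1) by [].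
have vN : v ^+ N = -1 := oddroot_exp N1 defv.
have vi : 0 <= 'Im v := ltW (oddroot_Im oN N1 defv).
have vK : v ^+ (M * N) = -1 by rewrite mulnC exprM vN -signr_odd oM.
have [j vE jP] := oddroot_chain oK K1 defw vK vi.
have Mj : (M %| j.*2.+1)%N.
  have : v ^+ (N.*2) = 1 by rewrite -muln2 exprM vN sqrrN expr1n.
  rewrite vE -exprM => /eqP; rewrite -(prim_order_dvd wp) -[(M * N).*2]muln2.
  by rewrite -[N.*2]muln2 mulnA !dvdn_pmul2r // odd_gt0.
have ME : M = (M./2).*2.+1 by rewrite -[LHS]odd_double_half oM.
have [|wi wr] := jP M./2.
  by rewrite -leq_double -ltnS -ME; apply: dvdn_leq.
rewrite -ME in wi wr.
have wMN : (w ^+ M) ^+ N = -1 by rewrite -exprM.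
apply: unit_upper_inj => //; [exact: oddroot_norm wMN|exact: oddroot_norm vN|].
by apply/eqP; rewrite eq_le wr andbT (oddroot_Re N1 defv).
Qed.

Lemma frac_num_den (q : rat) (a N : nat) : (0 < N)%N -> q = a%:R / N%:R ->
  (`|numq q| * N = a * `|denq q|)%N.
Proof.
move=> N0 qE; have N0' : N%:R != 0 :> rat by rewrite pnatr_eq0 -lt0n.
have q0 : 0 <= q by rewrite qE divr_ge0 ?ler0n.
have d0 : (denq q)%:~R != 0 :> rat by rewrite intr_eq0 denq_neq0.
have e : (numq q)%:~R * N%:R = a%:R * (denq q)%:~R :> rat.
  apply: (mulIf (invr_neq0 N0')); rewrite mulfK // mulrAC -qE.
  by rewrite -{2}[q]divq_num_den mulfVK.
apply/eqP; rewrite -(eqr_nat rat) !natrM; apply/eqP.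
by rewrite !natr_absz !ger0_norm ?numq_ge0 // ?ltW ?denq_gt0.
Qed.

Lemma frac_den_dvd (q : rat) (a N : nat) : (0 < N)%N -> q = a%:R / N%:R ->
  (`|denq q| %| N)%N.
Proof.
move=> N0 /(frac_num_den N0) e.
have := coprime_num_den q; rewrite coprime_sym => /Gauss_dvdr <-.
by rewrite e dvdn_mull.
Qed.

Lemma fracq_nat (c N : nat) : (0 < N)%N -> Defs.fracq (c%:R / N%:R) = (c %% N)%:R / N%:R.
Proof.
move=> N0; have N0' : N%:R != 0 :> rat by rewrite pnatr_eq0 -lt0n.
have N1 : 0 < N%:R :> rat by rewrite ltr0n.
rewrite /Defs.fracq; set f := Num.floor _; have -> : f = (c %/ N)%:Z.
  apply: floor_def; rewrite -(PoszD _ 1) addn1 -!pmulrn.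
  rewrite ler_pdivlMr // ltr_pdivrMr // -!natrM ler_nat ltr_nat.
  by rewrite leq_divM ltn_ceil.
by rewrite {1}(divn_eq c N) natrD natrM mulrDl mulfK // -pmulrn addrC addrA addNr add0r.
Qed.

Lemma norm_unity (z : algC) n : (0 < n)%N -> z ^+ n = 1 -> `|z| = 1.
Proof.
by move=> n0 zn; apply/eqP; rewrite -(pexpr_eq1 n0 (normr_ge0 z)) -normrX zn normr1.
Qed.

Section RootsOfUnity.
Variable p : nat.
Hypotheses (p_pr : prime p) (p_odd : odd p).

(* [eprim k] is e^{2 pi i / p^k}; [N.-root (-1)] being characterised only by a maximal real part, *)
(* the compatibility of these choices, [eprim_tower], rests on [rootN1_tower].                    *)
Definition eprim (k : nat) : algC := (p ^ k).-root (-1) ^+ 2.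

Lemma expiE a k : expi a (p ^ k) = eprim k ^+ a.
Proof. by rewrite /expi exprM. Qed.

Lemma eprim_tower j k : eprim (j + k) ^+ (p ^ j) = eprim k.
Proof. by rewrite /eprim exprAC expnD rootN1_tower ?oddX ?p_odd ?orbT. Qed.

Lemma eprim_prim k : (p ^ k).-primitive_root (eprim k).
Proof.
case: k => [|k].
  apply/andP; split=> //; apply/forallP => i.
  by rewrite ord1 unity_rootE /eprim root1C sqrrN !expr1n !eqxx.
have K1 : (1 < p ^ k.+1)%N by rewrite (ltn_exp2l 0) ?prime_gt1.
have oK : odd (p ^ k.+1) by rewrite oddX p_odd.
have d2 : (p ^ k.+1 %| (p ^ k.+1).*2)%N by rewrite -muln2 dvdn_mulr.
have := dvdn_prim_root (oddroot_prim oK K1 (erefl _)) d2.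
by rewrite -mul2n mulnK // expn_gt0 prime_gt0.
Qed.

Lemma pX_gt0 k : (0 < p ^ k)%N. Proof. by rewrite expn_gt0 prime_gt0. Qed.

Lemma qz_rep (x : QZp p) : exists k, forall K, (k <= K)%N ->
  exists2 a, (a < p ^ K)%N & val x = a%:R / (p ^ K)%:R.
Proof.
case: x => q /= /and3P[q0 q1 /p_natP[k dE]]; exists k => K kK.
have num0 : 0 <= numq q by rewrite numq_ge0.
have qE : q = (`|numq q| * p ^ (K - k))%:R / (p ^ K)%:R.
  have pn0 : (p ^ (K - k))%:R != 0 :> rat by rewrite pnatr_eq0 -lt0n pX_gt0.
  rewrite -{1}[q]divq_num_den -(ger0_norm (ltW (denq_gt0 q))) -natr_absz dE.
  by rewrite -{1}(ger0_norm num0) -natr_absz -{2}(subnK kK) expnD mulnC !natrM -mulf_div divff ?mul1r.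
exists (`|numq q| * p ^ (K - k))%N => //.
by move: q1; rewrite {1}qE ltr_pdivrMr ?ltr0n ?pX_gt0 // mul1r ltr_nat.
Qed.

Lemma qzexpE (x : QZp p) K a : val x = a%:R / (p ^ K)%:R -> qzexp x = eprim K ^+ a.
Proof.
move=> xE; have e := frac_num_den (pX_gt0 K) xE; have d := frac_den_dvd (pX_gt0 K) xE.
have /p_natP[j dE] : p.-nat `|denq (val x)|%N by case: x {xE e d} => q /= /and3P[].
rewrite dE dvdn_Pexp2l ?prime_gt1 // in d; rewrite /qzexp dE expiE.
rewrite -(eprim_tower (K - j)) subnK // -exprM; congr (_ ^+ _).
apply/eqP; rewrite mulnC -(eqn_pmul2r (pX_gt0 j)) -mulnA -expnD subnK // e dE.
by rewrite eqxx.
Qed.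

Definition mkqz (K a : nat) : QZp p := insubd (qz0 p) ((a %% p ^ K)%:R / (p ^ K)%:R).

Lemma val_mkqz K a : val (mkqz K a) = (a %% p ^ K)%:R / (p ^ K)%:R.
Proof.
rewrite insubdK //; apply/and3P; split.
- by rewrite divr_ge0 ?ler0n.
- by rewrite ltr_pdivrMr ?ltr0n ?pX_gt0 // mul1r ltr_nat ltn_pmod ?pX_gt0.
- by apply: pnat_dvd (frac_den_dvd (pX_gt0 K) (erefl _)) _; rewrite pnatX pnat_id.
Qed.

Lemma qzexp_mkqz K a : qzexp (mkqz K a) = eprim K ^+ a.
Proof. by rewrite (qzexpE (val_mkqz K a)) (prim_expr_mod (eprim_prim K)). Qed.

Lemma qz_rep2 (x y : QZp p) : exists K a b, [/\ (a < p ^ K)%N, (b < p ^ K)%N,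
  val x = a%:R / (p ^ K)%:R & val y = b%:R / (p ^ K)%:R].
Proof.
have [[k kP] [l lP]] := (qz_rep x, qz_rep y).
have [a aK xE] := kP _ (leq_maxl k l); have [b bK yE] := lP _ (leq_maxr k l).
by exists (maxn k l), a, b.
Qed.

Lemma qzaddE (x y : QZp p) K a b : val x = a%:R / (p ^ K)%:R ->
  val y = b%:R / (p ^ K)%:R -> qzadd x y = mkqz K (a + b).
Proof.
by move=> xE yE; rewrite /qzadd xE yE -mulrDl -natrD fracq_nat ?pX_gt0.
Qed.

Lemma qzexpD (x y : QZp p) : qzexp (qzadd x y) = qzexp x * qzexp y.
Proof.
have [K [a [b [_ _ xE yE]]]] := qz_rep2 x y.
by rewrite (qzaddE xE yE) qzexp_mkqz exprD (qzexpE xE) (qzexpE yE).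
Qed.

Lemma qzexp_inj : injective (@qzexp p).
Proof.
move=> x y; have [K [a [b [aK bK xE yE]]]] := qz_rep2 x y.
rewrite (qzexpE xE) (qzexpE yE) => /eqP; rewrite (eq_prim_root_expr (eprim_prim K)).
by rewrite !modn_small // => /eqP ab; apply: val_inj; rewrite xE yE ab.
Qed.

Lemma qzexp0 : qzexp (qz0 p) = 1.
Proof. by rewrite (@qzexpE _ 0 0) // mul0r. Qed.

Lemma norm_qzexp (x : QZp p) : `|qzexp x| = 1.
Proof.
have [k /(_ k (leqnn k))[a _ xE]] := qz_rep x.
by rewrite (qzexpE xE) normrX (norm_unity (pX_gt0 k) (prim_expr_order (eprim_prim k))) expr1n.
Qed.

Lemma qzexp_neq0 (x : QZp p) : qzexp x != 0.
Proof. by rewrite -normr_eq0 norm_qzexp oner_eq0. Qed.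

Lemma qz_div (x : QZp p) : exists y : QZp p, qzexp y ^+ p == qzexp x.
Proof.
have [k /(_ k (leqnn k))[a _ xE]] := qz_rep x; exists (mkqz (1 + k) a).
by have e := eprim_tower 1 k; rewrite qzexp_mkqz (qzexpE xE) exprAC -e expn1.
Qed.

Lemma qz_root (z : algC) : z ^+ p = 1 -> exists x : QZp p, qzexp x == z.
Proof.
move=> zp; have := eprim_prim 1; rewrite expn1 => /prim_rootP/(_ _ zp)[i zE].
by exists (mkqz 1 i); rewrite qzexp_mkqz zE.
Qed.

Lemma zetaE (x : 'F_p) : zeta x = eprim 1 ^+ x.
Proof. by rewrite /zeta -expiE expn1. Qed.

Lemma zeta_nat (m : nat) : zeta (m%:R : 'F_p) = eprim 1 ^+ m.
Proof.
by rewrite zetaE val_Fp_nat // -[X in (_ %% X)%N]expn1 (prim_expr_mod (eprim_prim 1)).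
Qed.

Lemma zetaD (x y : 'F_p) : zeta (x + y) = zeta x * zeta y.
Proof. by rewrite -[x]natr_Zp -[y]natr_Zp -natrD !zeta_nat exprD. Qed.

Lemma zeta0 : zeta (0 : 'F_p) = 1.
Proof. by rewrite zetaE. Qed.

Lemma zetaMn (x : 'F_p) m : zeta (x *+ m) = zeta x ^+ m.
Proof. by elim: m => [|m IH]; rewrite ?mulr0n ?zeta0 // mulrS zetaD IH exprS. Qed.

Lemma zeta_inj : injective (@zeta p).
Proof.
move=> x y /eqP; rewrite !zetaE (eq_prim_root_expr (eprim_prim 1)) expn1.
have lt (z : 'F_p) : (z < p)%N by apply: leq_trans (ltn_ord z) _; rewrite Fp_cast.
by rewrite !modn_small // => /eqP/val_inj.
Qed.

Lemma zeta_exp (x : 'F_p) : zeta x ^+ p = 1.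
Proof. by rewrite -zetaMn -mulr_natr (pchar_Fp_0 p_pr) // mulr0 zeta0. Qed.

Lemma norm_zeta (x : 'F_p) : `|zeta x| = 1.
Proof. exact: norm_unity (prime_gt0 p_pr) (zeta_exp x). Qed.

Lemma zeta_neq0 (x : 'F_p) : zeta x != 0.
Proof. by rewrite -normr_eq0 norm_zeta oner_eq0. Qed.

Lemma zeta_surj (z : algC) : z ^+ p = 1 -> exists x : 'F_p, z == zeta x.
Proof.
move=> zp; have := eprim_prim 1; rewrite expn1 => /prim_rootP/(_ _ zp)[i zE].
by exists (i%:R); rewrite zeta_nat zE.
Qed.

End RootsOfUnity.

(** * Newton identities *)

Definition esymp (s : seq algC) : {poly algC} := \prod_(x <- s) (1 + x *: 'X).

Lemma esymp_coef0 s : (esymp s)`_0 = 1.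
Proof.
elim: s => [|x s IH]; rewrite /esymp ?big_nil ?coef1 // big_cons -/(esymp s).
by rewrite mulrDl mul1r coefD -scalerAl coefZ coefXM /= mulr0 addr0.
Qed.

Lemma esymp_cons x s k : (esymp (x :: s))`_k.+1 = (esymp s)`_k.+1 + x * (esymp s)`_k.
Proof.
by rewrite /esymp big_cons mulrDl mul1r coefD -scalerAl coefZ coefXM.
Qed.

Lemma newton_identity (s : seq algC) k :
  k.+1%:R * (esymp s)`_k.+1 =
  \sum_(i < k.+1) (-1) ^+ i * (\sum_(x <- s) x ^+ i.+1) * (esymp s)`_(k - i).
Proof.
elim: s k => [|x s IH] k.
  rewrite /esymp big_nil coef1 mulr0 big1 // => i _.
  by rewrite big_nil mulr0 mul0r.
have geom m : \sum_(i < m.+1) (-1) ^+ i * x ^+ i.+1 * (esymp (x :: s))`_(m - i) =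
    x * (esymp s)`_m.
  elim: m => [|m IHm].
    by rewrite big_ord1 expr0 mul1r subnn !esymp_coef0 mulr1.
  rewrite big_ord_recl subn0 expr0 mul1r expr1 esymp_cons.
  have -> : \sum_(i < m.+1) (-1) ^+ bump 0 i * x ^+ (bump 0 i).+1 *
      (esymp (x :: s))`_(m.+1 - bump 0 i) = - x * (x * (esymp s)`_m).
    rewrite -IHm mulr_sumr; apply: eq_bigr => i _.
    by rewrite /bump /= add1n subSS !exprS; ring.
  by ring.
have rhs m : \sum_(i < m.+1) (-1) ^+ i * (\sum_(y <- s) y ^+ i.+1) * (esymp (x :: s))`_(m - i) =
    m.+1%:R * (esymp s)`_m.+1 + x * (m%:R * (esymp s)`_m).
  rewrite IH; case: m => [|m].
    by rewrite !big_ord1 !esymp_coef0 mul0r mulr0 addr0.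
  rewrite [in RHS]IH big_ord_recr [in RHS]big_ord_recr /= subnn !esymp_coef0.
  rewrite [in RHS]addrAC; congr (_ + _); rewrite mulr_sumr -big_split /=; apply: eq_bigr => i _.
  have -> : (m.+1 - i = (m - i).+1)%N by rewrite subSn // -ltnS.
  by rewrite esymp_cons; ring.
under eq_bigr => i _ do rewrite big_cons mulrDr mulrDl.
by rewrite big_split /= geom rhs esymp_cons -[in LHS]natr1; ring.
Qed.

Lemma size_newton_seq pw k : size (newton_seq pw k) = k.+1.
Proof. by elim: k => //= k IH; rewrite size_rcons IH. Qed.

Lemma nth_newton_seq pw k j : (j <= k)%N -> nth 0 (newton_seq pw k) j = elem_of_pw pw j.
Proof.
elim: k => [|k IH]; first by rewrite leqn0 => /eqP->.
rewrite leq_eqVlt ltnS => /orP[/eqP->//|jk].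
by rewrite /= nth_rcons size_newton_seq ltnS jk IH.
Qed.

Lemma elem_of_pw0 pw : elem_of_pw pw 0 = 1. Proof. by []. Qed.

Lemma elem_of_pwS pw k : elem_of_pw pw k.+1 =
  k.+1%:R^-1 * \sum_(i < k.+1) (-1) ^+ i * pw i.+1 * elem_of_pw pw (k - i).
Proof.
rewrite [LHS]/elem_of_pw [in LHS]/= nth_rcons size_newton_seq ltnn eqxx; congr (_ * _).
by apply: eq_bigr => i _; rewrite nth_newton_seq ?leq_subr.
Qed.

Lemma elem_of_pw_esymp (s : seq algC) pw k :
  (forall i, pw i = \sum_(x <- s) x ^+ i) -> elem_of_pw pw k = (esymp s)`_k.
Proof.
move=> pwE; elim/ltn_ind: k => -[_|k IH]; first by rewrite elem_of_pw0 esymp_coef0.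
rewrite elem_of_pwS; apply: (mulfI (_ : k.+1%:R != 0)); first by rewrite pnatr_eq0.
rewrite mulVKf ?pnatr_eq0 // newton_identity; apply: eq_bigr => i _.
by rewrite pwE IH ?ltnS ?leq_subr.
Qed.

Lemma elem_of_pw_lacunary pw k : (forall i, (0 < i < k)%N -> pw i = 0) -> (0 < k)%N ->
  elem_of_pw pw k = k%:R^-1 * ((-1) ^+ k.-1 * pw k).
Proof.
case: k => // k pw0 _; rewrite elem_of_pwS big_ord_recr /= subnn elem_of_pw0 mulr1.
by rewrite big1 ?add0r // => i _; rewrite pw0 ?mulr0 ?mul0r //= ltnS.
Qed.

Lemma esymp_nseq (N : nat) (x : algC) k : (esymp (nseq N x))`_k = 'C(N, k)%:R * x ^+ k.
Proof.
elim: N k => [|N IH] [|k]; rewrite ?esymp_coef0 ?bin0 ?mulr1 //.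
  by rewrite /esymp big_nil coef1 bin0n mul0r.
by rewrite /= esymp_cons !IH binS natrD exprS; ring.
Qed.

Lemma esymp_subsets (s : seq algC) k :
  (esymp s)`_k = \sum_(I : {set 'I_(size s)} | #|I| == k) \prod_(i in I) s`_i.
Proof.
rewrite /esymp (big_nth 0) big_mkord.
under eq_bigr => i _ do rewrite addrC.
rewrite bigA_distr coef_sum [RHS]big_mkcond; apply: eq_bigr => I _.
rewrite -big_mkcond /=.
have -> : \prod_(i in I) (s`_i *: 'X) = (\prod_(i in I) s`_i) *: 'X^#|I|.
  by rewrite scaler_prod prodr_const.
by rewrite coefZ coefXn eq_sym; case: eqP => _; rewrite ?mulr1 ?mulr0.
Qed.

(** * Evaluation of Z[Theta] at duals *)

Section Duals.
Variables (n p : nat).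
Hypotheses (p_pr : prime p) (p_odd : odd p).
Local Notation Th := (Theta n p).
Local Notation qzD := (qzexpD p_pr p_odd).
Local Notation qzI := (qzexp_inj p_pr p_odd).
Local Notation qz1 := (qzexp0 p_pr p_odd).

Definition dual0 : Th -> QZp p := fun=> qz0 p.
Definition dual_nat k (th : Th -> QZp p) : Th -> QZp p := iter k (dual_add th) dual0.
Definition dual_coord (i : 'I_n) : Th -> QZp p := fun a => a i.

Lemma is_dualP (th : Th -> QZp p) :
  is_dual th <-> forall a b, qzexp (th (thadd a b)) = qzexp (th a) * qzexp (th b).
Proof.
split=> [h a b|h a b]; first by rewrite h qzD.
by apply: qzI; rewrite h qzD.
Qed.

Lemma qzexp_dual_add (th th' : Th -> QZp p) a :
  qzexp (dual_add th th' a) = qzexp (th a) * qzexp (th' a).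
Proof. exact: qzD. Qed.

Lemma qzexp_dual0 a : qzexp (dual0 a) = 1. Proof. exact: qz1. Qed.

Lemma qzexp_dual_nat k th a : qzexp (dual_nat k th a) = qzexp (th a) ^+ k.
Proof. by elim: k => [|k IH]; rewrite ?qz1 // /dual_nat iterS qzD IH exprS. Qed.

Lemma is_dual0 : @is_dual n p dual0.
Proof. by apply/is_dualP => a b; rewrite !qz1 mulr1. Qed.

Lemma is_dual_add (th th' : Th -> QZp p) : is_dual th -> is_dual th' -> is_dual (dual_add th th').
Proof.
move=> /is_dualP h /is_dualP h'; apply/is_dualP => a b.
by rewrite !qzexp_dual_add h h' mulrACA.
Qed.

Lemma is_dual_nat k (th : Th -> QZp p) : is_dual th -> is_dual (dual_nat k th).
Proof.
by move=> /is_dualP h; apply/is_dualP => a b; rewrite !qzexp_dual_nat h exprMn.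
Qed.

Lemma is_dual_coord (i : 'I_n) : is_dual (dual_coord i).
Proof. by move=> a b; rewrite /dual_coord ffunE. Qed.

Lemma dual_addC th th' : dual_add th th' = dual_add th' th :> (Th -> QZp p).
Proof.
by apply: functional_extensionality => a; apply: qzI; rewrite !qzexp_dual_add mulrC.
Qed.

Lemma theta_eqP (a b : Th) : (forall th, is_dual th -> qzexp (th a) = qzexp (th b)) -> a = b.
Proof. by move=> h; apply/ffunP => i; apply: qzI; apply: (h _ (is_dual_coord i)). Qed.

Section OneDual.
Variable th : Th -> QZp p.
Hypothesis thP : is_dual th.

Lemma qzexp_thadd a b : qzexp (th (thadd a b)) = qzexp (th a) * qzexp (th b).
Proof. by rewrite thP qzD. Qed.

Lemma qzexp_th0 : qzexp (th (th0 n p)) = 1.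
Proof.
have := qzexp_thadd (th0 n p) (th0 n p).
have -> : thadd (th0 n p) (th0 n p) = th0 n p.
  by apply/ffunP => i; rewrite !ffunE; apply: qzI; rewrite qzD qz1 mulr1.
by move/eqP; rewrite -{1}[qzexp _]mulr1 (inj_eq (mulfI (qzexp_neq0 p_pr p_odd _))) => /eqP.
Qed.

Lemma qzexp_thnat k a : qzexp (th (thnat k a)) = qzexp (th a) ^+ k.
Proof. by elim: k => [|k IH]; rewrite ?qzexp_th0 // /thnat iterS qzexp_thadd IH exprS. Qed.

Lemma qzexp_tors a : th_tors a -> qzexp (th a) ^+ p = 1.
Proof. by move=> /eqP e; rewrite -qzexp_thnat e qzexp_th0. Qed.

Lemma qzexp_thsum (I : finType) (P : pred I) (F : I -> Th) :
  qzexp (th (\big[@thadd n p/th0 n p]_(i | P i) F i)) = \prod_(i | P i) qzexp (th (F i)).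
Proof. exact: (big_morph (fun a => qzexp (th a)) qzexp_thadd qzexp_th0). Qed.
End OneDual.

Lemma th_torsP (a : Th) : (forall th, is_dual th -> qzexp (th a) ^+ p = 1) -> th_tors a.
Proof.
by move=> h; apply/eqP/theta_eqP => th thP; rewrite qzexp_thnat // h // qzexp_th0.
Qed.

Local Notation ZT := (ZTh n p).

Lemma zchar_sub (x : ZT) th (s : seq Th) : uniq s -> {subset dom x <= s} ->
  zchar x th = \sum_(a <- s) (coeff a x)%:~R * qzexp (th a).
Proof.
move=> us sub; rewrite (bigID (mem (dom x))) /= [X in _ + X]big1 ?addr0; last first.
  by move=> a /coeff_outdom->; rewrite mul0r.
rewrite -big_filter; apply: perm_big; apply: uniq_perm; rewrite ?uniq_dom ?filter_uniq //.
move=> a; rewrite mem_filter /=; case ax: (a \in dom x) => //=.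
by rewrite sub.
Qed.

Lemma zcharD (x y : ZT) th : zchar (x + y) th = zchar x th + zchar y th.
Proof.
pose s := undup (dom x ++ dom y); have us : uniq s by apply: undup_uniq.
have sx : {subset dom x <= s} by move=> a; rewrite mem_undup mem_cat => ->.
have sy : {subset dom y <= s} by move=> a; rewrite mem_undup mem_cat orbC => ->.
have sxy : {subset dom (x + y) <= s}.
  by move=> a /domD_subset; rewrite mem_undup.
rewrite !(@zchar_sub _ _ s) // -big_split; apply: eq_bigr => a _ /=.
by rewrite coeffD intrD mulrDl.
Qed.

Lemma zchar0 th : zchar (0 : ZT) th = 0.
Proof. by rewrite /zchar dom0 big_nil. Qed.

Lemma zchar_sum (I : Type) (r : seq I) (P : pred I) (F : I -> ZT) th :
  zchar (\sum_(i <- r | P i) F i) th = \sum_(i <- r | P i) zchar (F i) th.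
Proof. exact: (big_morph (fun x : ZT => zchar x th) (fun x y => zcharD x y th) (zchar0 th)). Qed.

Lemma zcharN (x : ZT) th : zchar (- x) th = - zchar x th.
Proof. by apply/eqP; rewrite -addr_eq0 -zcharD addNr zchar0. Qed.

Lemma zcharMn (x : ZT) k th : zchar (x *+ k) th = zchar x th *+ k.
Proof. by elim: k => [|k IH]; rewrite ?zchar0 // !mulrS zcharD IH. Qed.

Lemma zcharMz (x : ZT) (k : int) th : zchar (x *~ k) th = k%:~R * zchar x th.
Proof.
case: k => k; first by rewrite -pmulrn zcharMn -[_%:~R]/(k%:R) mulr_natl.
by rewrite NegzE mulrNz zcharN -pmulrn zcharMn mulrNz mulNr mulr_natl.
Qed.

Lemma zchar_scal z a th : zchar (zscal z a : ZT) th = z%:~R * qzexp (th a).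
Proof.
have [->|z0] := eqVneq z 0; first by rewrite /zscal freegU0 zchar0 mul0r.
by rewrite /zchar /zscal domU // big_seq1 coeffU eqxx mulr1.
Qed.

Lemma zchar_delta a th : zchar (zdelta a : ZT) th = qzexp (th a).
Proof. by rewrite (zchar_scal 1) mul1r. Qed.

Lemma zchar_one th : is_dual th -> zchar (zone n p) th = 1.
Proof. by move=> h; rewrite zchar_delta qzexp_th0. Qed.

Lemma zchar_mul (x y : ZT) th : is_dual th -> zchar (zmul x y) th = zchar x th * zchar y th.
Proof.
move=> h; rewrite zchar_sum [in RHS]/zchar mulr_suml; apply: eq_bigr => a _.
rewrite zchar_sum mulr_sumr; apply: eq_bigr => b _.
by rewrite zchar_scal qzexp_thadd // intrM mulrACA.
Qed.

Lemma zchar_psi k (x : ZT) th : is_dual th ->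
  zchar (zpsi k x) th = \sum_(a <- dom x) (coeff a x)%:~R * qzexp (th a) ^+ k.
Proof.
by move=> h; rewrite zchar_sum; apply: eq_bigr => a _; rewrite zchar_scal qzexp_thnat.
Qed.

Lemma zchar_dual_nat k (x : ZT) th :
  zchar x (dual_nat k th) = \sum_(a <- dom x) (coeff a x)%:~R * qzexp (th a) ^+ k.
Proof. by apply: eq_bigr => a _; rewrite qzexp_dual_nat. Qed.

Lemma zchar_dual_nat1 (x : ZT) th : zchar x (dual_nat 1 th) = zchar x th.
Proof. by rewrite zchar_dual_nat; apply: eq_bigr => a _; rewrite expr1. Qed.

Lemma deg_zchar (x : ZT) : (deg x)%:~R = zchar x dual0 :> algC.
Proof.
rewrite -[in LHS](freeg_sumE x) raddf_sum /= rmorph_sum; apply: eq_bigr => a _.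
by rewrite degU qzexp_dual0 mulr1.
Qed.

(* Artin's argument: comparing the relation at [th] and at [th0 + th] eliminates one character. *)
Lemma dual_indep (s : seq Th) (c : Th -> algC) : uniq s ->
  (forall th, is_dual th -> \sum_(a <- s) c a * qzexp (th a) = 0) ->
  forall a, a \in s -> c a = 0.
Proof.
elim: s c => [|b s IH] c //= /andP[bs us] h.
have cs a : a \in s -> c a = 0.
  move=> a_s; have [i ab] : exists i, a i != b i.
    apply/existsP; apply: contraNT bs => /existsPn e.
    by rewrite (_ : b = a) //; apply/ffunP => i; move: (e i); rewrite negbK => /eqP.
  pose th0 := dual_coord i; have h0 := is_dual_coord i.
  suff /(IH (fun a => c a * (qzexp (th0 a) - qzexp (th0 b))) us)/(_ a a_s)/eqP :
      forall th, is_dual th ->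
      \sum_(a <- s) c a * (qzexp (th0 a) - qzexp (th0 b)) * qzexp (th a) = 0.
    by rewrite mulf_eq0 subr_eq0 (inj_eq qzI) (negPf ab) orbF => /eqP.
  move=> th thP.
  have e1 := h _ (is_dual_add h0 thP); have e2 := h _ thP; rewrite !big_cons in e1 e2.
  rewrite qzexp_dual_add in e1.
  transitivity ((c b * (qzexp (th0 b) * qzexp (th b)) +
     \sum_(a <- s) c a * qzexp (dual_add th0 th a)) - qzexp (th0 b) * (c b * qzexp (th b)
       + \sum_(a <- s) c a * qzexp (th a))); last by rewrite e1 e2 mulr0 subr0.
  rewrite mulrDr opprD addrACA (_ : _ - _ = 0) ?add0r; last by ring.
  rewrite mulr_sumr -sumrB; apply: eq_bigr => d _.
  by rewrite qzexp_dual_add; ring.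
move=> a; rewrite inE => /orP[/eqP->|/cs//].
have := h _ is_dual0; rewrite big_cons qzexp_dual0 mulr1 big1_seq ?addr0 // => d /andP[_ ds].
by rewrite cs ?mul0r.
Qed.

Lemma zchar_inj (x y : ZT) : (forall th, is_dual th -> zchar x th = zchar y th) -> x = y.
Proof.
move=> h; apply/eqP; rewrite -subr_eq0 -dom_eq0; set z := x - y.
have z0 th : is_dual th -> zchar z th = 0 by move=> thP; rewrite zcharD zcharN h ?subrr.
case E: (dom z) => [//|a s]; have az : a \in dom z by rewrite E mem_head.
have /eqP := dual_indep (uniq_dom z) z0 az.
by rewrite intr_eq0 -[_ == 0]negbK -mem_dom az.
Qed.

Lemma zNP (x : ZT) : reflect (forall a, 0 <= coeff a x) (zN x).
Proof.
apply: (iffP allP) => [h a|h a _]; last exact: h.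
by have [/h//|/coeff_outdom->] := boolP (a \in dom x).
Qed.

Lemma zN_delta a : zN (zdelta a : ZT).
Proof. by apply/zNP => b; rewrite coeffU mul1r; case: (a == b). Qed.

Lemma zN_add (x y : ZT) : zN x -> zN y -> zN (x + y).
Proof. by move=> /zNP hx /zNP hy; apply/zNP => a; rewrite coeffD addr_ge0. Qed.

Lemma zN_muln (x : ZT) k : zN x -> zN (x *+ k).
Proof. by move=> /zNP hx; apply/zNP => a; rewrite coeffMn mulrn_wge0. Qed.

Lemma zN_sum (I : Type) (r : seq I) (P : pred I) (F : I -> ZT) :
  (forall i, P i -> zN (F i)) -> zN (\sum_(i <- r | P i) F i).
Proof.
move=> h; apply: (big_ind (fun x : ZT => zN x)) => //; last exact: zN_add.
by apply/zNP => a; rewrite coeff0.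
Qed.

Lemma zN_psi k (x : ZT) : zN x -> zN (zpsi k x).
Proof.
move=> /zNP hx; apply: zN_sum => a _; apply/zNP => b; rewrite coeffU.
by rewrite mulr_ge0 // ler0n.
Qed.

Lemma sum_zexpand (x : ZT) (F : Th -> algC) : zN x ->
  \sum_(a <- zexpand x) F a = \sum_(a <- dom x) (coeff a x)%:~R * F a.
Proof.
move=> /zNP hx; rewrite /zexpand big_flatten big_map; apply: eq_bigr => a _.
rewrite big_nseq iter_addr_0 -mulr_natl natr_absz ger0_norm //.
Qed.

Lemma mem_zexpand (x : ZT) a : (a \in zexpand x) = (a \in dom x).
Proof.
apply/flattenP/idP => [[s /mapP[b bx ->]]|ax].
  by rewrite mem_nseq => /andP[_ /eqP->].
exists (nseq `|coeff a x| a); first by apply/mapP; exists a.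
by rewrite mem_nseq eqxx andbT absz_gt0 -mem_dom.
Qed.

Lemma size_zexpand (x : ZT) : zN x -> (size (zexpand x))%:Z = deg x.
Proof.
move=> xN; apply/eqP; rewrite -(eqr_int algC) deg_zchar; apply/eqP.
have := sum_zexpand (fun=> 1) xN; rewrite big_const_seq count_predT iter_addr_0 => e.
by rewrite -pmulrn e; apply: eq_bigr => a _; rewrite qzexp_dual0.
Qed.

Lemma zchar_expand (x : ZT) th : zN x -> zchar x th = \sum_(a <- zexpand x) qzexp (th a).
Proof. by move=> xN; rewrite sum_zexpand. Qed.

Lemma zchar_lam k (x : ZT) th : is_dual th -> zN x ->
  zchar (zlam k x) th = elem_of_pw (fun i => zchar x (dual_nat i th)) k.
Proof.
move=> h xN; rewrite (@elem_of_pw_esymp [seq qzexp (th a) | a <- zexpand x]); last first.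
  by move=> i; rewrite big_map zchar_dual_nat sum_zexpand.
rewrite esymp_subsets /zlam /zlam_seq zchar_sum size_map; apply: eq_bigr => I _.
rewrite zchar_delta qzexp_thsum //; apply: eq_bigr => i _.
by rewrite (nth_map (th0 n p)).
Qed.
End Duals.

(** * Characters of the Heisenberg group *)

Lemma sum_mult_char (V : finZmodType) (h : V -> algC) (v0 : V) :
  (forall u v, h (u + v) = h u * h v) -> h v0 != 1 -> \sum_v h v = 0.
Proof.
move=> hD hv0; set S := \sum_v h v.
have : S = h v0 * S.
  rewrite /S [in LHS](reindex_inj (addrI v0)) mulr_sumr.
  by apply: eq_bigr => v _; rewrite hD.
move/eqP; rewrite -subr_eq0 -{1}[S]mul1r -mulrBl mulf_eq0 subr_eq0 eq_sym (negPf hv0).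
by move/eqP.
Qed.

Lemma irr_mul_center (gT : finGroupType) (G : {group gT}) (i : Iirr G) g z :
  g \in G -> z \in 'Z(G)%g -> 'chi_i (g * z)%g = 'chi_i g * ('chi_i z / 'chi_i 1%g).
Proof.
move=> Gg Zz; have /irr_reprP[rG irrG chiE] := mem_irr i.
have Gz : z \in G by case/centerP: Zz.
have : z \in 'Z('chi_i)%CF by move: Zz; rewrite -cap_cfcenter_irr => /bigcapP/(_ i isT).
have := irr1_neq0 i.
rewrite chiE cfcenter_repr inE Gz => n0 /= /is_scalar_mxP[c rz].
rewrite !cfunE groupM // Gg Gz !mulr1n repr_mxM // rz mul_mx_scalar mxtraceZ mxtrace_scalar.
rewrite mulrC; congr (_ * _); move: n0; rewrite cfRepr1 => n0.
by rewrite group1 mulr1n repr_mx1 mxtrace1 -[c *+ _]mulr_natr mulfK.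
Qed.

Section DotForm.
Variable p : nat.
Hypotheses (p_pr : prime p) (p_odd : odd p).

Definition dotr m (v w : 'rV['F_p]_m) : 'F_p := (v *m w^T) 0 0.

Lemma dotrDl m (u v w : 'rV_m) : dotr (u + v) w = dotr u w + dotr v w.
Proof. by rewrite /dotr mulmxDl mxE. Qed.

Lemma dotrDr m (u v w : 'rV_m) : dotr u (v + w) = dotr u v + dotr u w.
Proof. by rewrite /dotr linearD /= mulmxDr mxE. Qed.

Lemma dotr0l m (w : 'rV_m) : dotr 0 w = 0.
Proof. by rewrite /dotr mul0mx mxE. Qed.

Lemma dotrZl m c (u w : 'rV_m) : dotr (c *: u) w = c * dotr u w.
Proof. by rewrite /dotr -scalemxAl mxE. Qed.

Lemma dotrC m (u v : 'rV_m) : dotr u v = dotr v u.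
Proof. by rewrite /dotr -[u in LHS]trmxK -trmx_mul mxE. Qed.

Lemma dotr_delta m (w : 'rV_m) j : dotr (delta_mx 0 j) w = w 0 j.
Proof. by rewrite /dotr -rowE !mxE. Qed.

Lemma rV_neq0_coord m (v : 'rV['F_p]_m) : v != 0 -> exists j, v 0 j != 0.
Proof.
move=> v0; apply/existsP; apply: contraNT v0 => /existsPn e; apply/eqP/rowP => j.
by rewrite mxE; apply/eqP; move: (e j); rewrite negbK.
Qed.

Lemma dotr_eq m (u v : 'rV_m) : (forall w, dotr w u = dotr w v) -> u = v.
Proof. by move=> h; apply/rowP => j; rewrite -!dotr_delta h. Qed.

Lemma Fp_char_dual m (h : 'rV['F_p]_m -> algC) :
  h 0 = 1 -> (forall u v, h (u + v) = h u * h v) -> exists w, forall v, h v = zeta (dotr v w).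
Proof.
move=> h0 hD.
have hMn v k : h (v *+ k) = h v ^+ k.
  by elim: k => [|k IH]; rewrite ?mulr0n // mulrS hD IH exprS.
have hp v : h v ^+ p = 1.
  by rewrite -hMn -scaler_nat pchar_Fp_0 // scale0r.
have [w wP] : exists w : 'rV['F_p]_m, forall j, h (delta_mx 0 j) == zeta (w 0 j).
  exists (\row_j xchoose (zeta_surj p_pr p_odd (hp (delta_mx 0 j)))) => j; rewrite mxE.
  exact: (xchooseP (zeta_surj p_pr p_odd (hp (delta_mx 0 j)))).
exists w => v; rewrite {1}[v]row_sum_delta {2}[v]row_sum_delta.
rewrite (big_morph h hD h0) /dotr mulmx_suml summxE.
rewrite (big_morph _ (zetaD p_pr p_odd) (zeta0 p)); apply: eq_bigr => j _.
rewrite -/(dotr _ _) dotrZl dotr_delta -{1}[v 0 j]natr_Zp scaler_nat hMn (eqP (wP j)).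
by rewrite -(zetaMn p_pr p_odd) -mulr_natl natr_Zp.
Qed.

Lemma sum_zeta_dot m (v : 'rV['F_p]_m) :
  \sum_w zeta (dotr v w) = if v == 0 then (p ^ m)%:R else 0.
Proof.
case: eqP => [->|/eqP v0].
  under eq_bigr => w _ do rewrite dotr0l zeta0.
  by rewrite sumr_const card_mx card_Fp // mul1n.
have [j vj] := rV_neq0_coord v0.
apply: (@sum_mult_char _ _ (delta_mx 0 j)) => [u w|]; first by rewrite dotrDr zetaD.
by rewrite dotrC dotr_delta -(zeta0 p) (inj_eq (zeta_inj p_pr p_odd)).
Qed.

Lemma zeta1_neq1 k : ~~ (p %| k)%N -> (zeta (1 : 'F_p)) ^+ k != 1.
Proof.
move=> pk; rewrite -(zetaMn p_pr p_odd) -(zeta0 p) (inj_eq (zeta_inj p_pr p_odd)).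
by rewrite -(dvdn_pcharf (pchar_Fp p_pr)).
Qed.

Lemma sum_zetaX k : ~~ (p %| k)%N -> \sum_(x : 'F_p) zeta x ^+ k = 0.
Proof.
move=> pk; apply: (@sum_mult_char _ _ 1) => [u w|]; last exact: zeta1_neq1.
by rewrite zetaD // exprMn.
Qed.

Lemma zeta_conj (x : 'F_p) k : (zeta x ^+ k)^* = zeta x ^+ (p.-1 * k).
Proof.
rewrite rmorphXn exprM; congr (_ ^+ _).
apply: (mulfI (zeta_neq0 p_pr p_odd x)); rewrite -exprS prednK ?prime_gt0 //.
by rewrite zeta_exp // -normCK norm_zeta // expr1n.
Qed.
End DotForm.

Section HeisChar.
Variables (p d : nat) (A : 'M['F_p]_(d.*2)).
Hypotheses (p_pr : prime p) (p_odd : odd p).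
Hypothesis alt : forall u, bform A u u = 0.
Hypothesis ndeg : A \in unitmx.
Local Notation b := (bform A).
Local Notation gT := (heis_of A).
Local Notation G := [set: heis_of A].
Local Notation hel x v := ((x, v) : heis_of A).

Lemma heis_mulE (x y : gT) : (x * y)%g = (x.1 + y.1 + b x.2 y.2, x.2 + y.2) :> gT.
Proof. by []. Qed.

Lemma heis_oneE : 1%g = (0, 0) :> gT. Proof. by []. Qed.

Lemma heis_inG (g : gT) : g \in G. Proof. by rewrite inE. Qed.
Local Hint Resolve heis_inG : core.

Lemma bform_asym u w : b u w = - b w u.
Proof.
apply/eqP; rewrite -addr_eq0; have := alt (u + w).
by rewrite bformDl !bformDr !alt add0r addr0 => ->.
Qed.

Lemma bform0r u : b u 0 = 0.
Proof. by rewrite bform_asym bform0l oppr0. Qed.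

Lemma bformMn u w k l : b (u *+ k) (w *+ l) = b u w *+ (k * l).
Proof.
have Ml v k' z : b (v *+ k') z = b v z *+ k'.
  by elim: k' => [|k' IH]; rewrite ?bform0l // !mulrS bformDl IH.
by rewrite Ml (bform_asym u) Ml -mulNrn -bform_asym -mulrnA mulnC.
Qed.

Lemma bform_repr (y : 'rV_(d.*2)) : exists w, forall v, b v w = dotr v y.
Proof.
exists (invmx A *m y^T)^T => v.
by rewrite /bform /dotr trmxK -mulmxA mulKVmx.
Qed.

Lemma heis_expg (x : gT) k : (x ^+ k)%g = (x.1 *+ k, x.2 *+ k) :> gT.
Proof.
elim: k => [|k IH]; first by rewrite !mulr0n.
rewrite expgS IH heis_mulE /= !mulrS (_ : b _ _ = 0) ?addr0 //.
by rewrite -{1}[x.2]mulr1n bformMn alt mul0rn.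
Qed.

Lemma heis_expp (x : gT) : (x ^+ p)%g = 1%g.
Proof.
rewrite heis_expg heis_oneE -[x.1 *+ p]mulr_natl -[x.2 *+ p]scaler_nat.
by rewrite pchar_Fp_0 // mul0r scale0r.
Qed.

Lemma heis_conjgE (x y : gT) : (x ^ y)%g = (x.1 + b x.2 y.2 *+ 2, x.2) :> gT.
Proof.
rewrite conjgE; case: x y => [x1 x2] [y1 y2].
rewrite !heis_mulE /= alt bformNl bformDr alt (bform_asym y2) !addr0 opprK.
by congr (_, _); [ring | rewrite [x2 + _]addrC addKr].
Qed.

Lemma two_neq0 : 2%:R != 0 :> 'F_p.
Proof.
rewrite -(dvdn_pcharf (pchar_Fp p_pr)); apply/negP => pd2; have p2 := @dvdn_leq p 2 isT pd2.
have := prime_gt1 p_pr; rewrite leq_eqVlt ltnNge p2 orbF => /eqP p2'.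
by move: p_odd; rewrite -p2'.
Qed.

Lemma heis_card : #|G| = (p * p ^ d.*2)%N.
Proof. by rewrite cardsT card_prod card_mx card_Fp // mul1n. Qed.

Lemma heis_center (g : gT) : g.2 = 0 -> g \in 'Z(G)%g.
Proof.
move=> g2; apply/centerP; split=> // y _; case: g g2 => [g1 g2] /= ->.
rewrite /commute !heis_mulE /= bform0l bform0r; congr (_, _); first by ring.
by rewrite addrC.
Qed.

Definition lam_mx (w : 'rV['F_p]_(d.*2)) (g : gT) : 'M[algC]_1 := (zeta (dotr g.2 w))%:M.

Lemma lam_mx_repr w : mx_repr G (lam_mx w).
Proof.
split=> [|x y _ _]; rewrite /lam_mx ?heis_mulE /=.
  by rewrite dotr0l zeta0.
by rewrite dotrDl zetaD // scalar_mxM.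
Qed.

Definition lam_rep w := MxRepresentation (lam_mx_repr w).

Lemma lam_cfE w g : cfRepr (lam_rep w) g = zeta (dotr g.2 w).
Proof. by rewrite cfunE heis_inG mulr1n mxtrace_scalar mulr1n. Qed.

Lemma lam_lin w : cfRepr (lam_rep w) \is a linear_char.
Proof. by rewrite qualifE /= cfRepr_char cfRepr1 eqxx. Qed.

Definition lamI w : Iirr G := cfIirr (cfRepr (lam_rep w)).

Lemma lamE w g : 'chi_(lamI w) g = zeta (dotr g.2 w).
Proof. by rewrite cfIirrE ?lin_char_irr ?lam_lin // lam_cfE. Qed.

Lemma lamI_Vstar w : lamI w \in @Vstar p d A.
Proof.
apply/andP; split; first by rewrite cfIirrE ?lin_char_irr ?lam_lin.
apply/subsetP => g; rewrite inE => /eqP g2.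
by rewrite cfkerEchar ?irr_char // !inE !lamE /= g2 eqxx.
Qed.

Lemma VstarP i : i \in @Vstar p d A -> exists w, i = lamI w.
Proof.
move=> /andP[lin /subsetP kerZ].
have hZ (g : gT) : g.2 = 0 -> 'chi_i g = 1.
  move=> g2; have := kerZ g; rewrite inE g2 eqxx => /(_ isT).
  by rewrite cfkerEchar ?irr_char // inE (lin_char1 lin) => /andP[_ /eqP].
have hV (x : 'F_p) v : 'chi_i (x, v) = 'chi_i (hel 0 v).
  have -> : hel x v = (hel x 0 * hel 0 v)%g by rewrite heis_mulE /= bform0l !addr0 add0r.
  by rewrite (lin_charM lin) // (hZ (hel x 0)) // mul1r.
have [||w wP] := @Fp_char_dual p p_pr p_odd _ (fun v => 'chi_i (hel 0 v)).
- exact: hZ.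
- by move=> u v; rewrite -(lin_charM lin) // heis_mulE /= !hV.
exists w; apply: irr_inj; apply/cfunP => -[x v].
by rewrite lamE hV wP.
Qed.

Lemma lamI_inj : injective lamI.
Proof.
move=> w w' e; apply: dotr_eq => v; apply: (zeta_inj p_pr p_odd).
by rewrite -(lamE w (hel 0 v)) e lamE.
Qed.

Lemma sum_VstarE (R : nmodType) (F : Iirr G -> R) :
  \sum_(i in @Vstar p d A) F i = \sum_w F (lamI w).
Proof.
rewrite -(big_imset _ (in2W lamI_inj)) /=; apply: eq_bigl => i.
apply/idP/imsetP => [/VstarP[w ->]|[w _ ->]]; first by exists w.
exact: lamI_Vstar.
Qed.

Definition sumV : 'CF(G) := \sum_(i in @Vstar p d A) 'chi_i.

Lemma sumVE (g : gT) : sumV g = if g.2 == 0 then (p ^ d.*2)%:R else 0.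
Proof.
rewrite /sumV sum_VstarE sum_cfunE; under eq_bigr => w _ do rewrite lamE.
exact: sum_zeta_dot.
Qed.

Lemma phi_zetaE (g : gT) : phi_zeta A g = if g.2 == 0 then (p ^ d)%:R * zeta g.1 else 0.
Proof. by rewrite cfunElock. Qed.

(* For [0 < k], the analogue of [phi_zeta A] for the central character [zeta ^+ k]. *)
Definition phik (k : nat) : 'CF(G) := (p ^ d)%:R ^- k.-1 *: phi_zeta A ^+ k.

Lemma pd_neq0 : (p ^ d)%:R != 0 :> algC.
Proof. by rewrite pnatr_eq0 -lt0n expn_gt0 prime_gt0. Qed.

Lemma phikE k (g : gT) : (0 < k)%N ->
  phik k g = if g.2 == 0 then (p ^ d)%:R * zeta g.1 ^+ k else 0.
Proof.
case: k => // k _; rewrite cfunE exp_cfunE // phi_zetaE; case: ifP => _.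
  by rewrite exprMn exprS mulrA mulrCA mulVf ?mulr1 ?expf_neq0 ?pd_neq0.
by rewrite expr0n mulr0.
Qed.

Lemma phik1 : phik 1 = phi_zeta A.
Proof. by rewrite /phik expr0 invr1 scale1r. Qed.

Lemma sum_heis (F : gT -> algC) :
  (forall g, g.2 != 0 -> F g = 0) -> \sum_(g in G) F g = \sum_(x : 'F_p) F (x, 0).
Proof.
move=> F0; transitivity (\sum_(g : gT) F g); first by apply: eq_bigl => g; rewrite inE.
transitivity (\sum_(x : 'F_p) \sum_(v : 'rV['F_p]_(d.*2)) F (x, v)).
  by rewrite pair_bigA; apply: eq_bigr => -[x v].
apply: eq_bigr => x _.
by rewrite (bigD1 0) //= big1 ?addr0 // => v v0; apply: F0.
Qed.

Lemma cfdot_phik k l : (0 < k)%N -> (0 < l)%N -> '[phik k, phik l] = ((k == l %[mod p])%N)%:R.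
Proof.
move=> k0 l0; rewrite cfdotE sum_heis => [|g g2]; last by rewrite !phikE // (negPf g2) mul0r.
have e (x : 'F_p) : phik k (x, 0) * (phik l (x, 0))^* =
    (p ^ d)%:R ^+ 2 * zeta x ^+ (k + p.-1 * l).
  rewrite !phikE //= eqxx rmorphM /= rmorph_nat (zeta_conj p_pr p_odd) exprD; ring.
under eq_bigr => x _ do rewrite e.
rewrite -mulr_sumr heis_card.
have pk : (p %| k + p.-1 * l)%N = (k == l %[mod p])%N.
  have e' : (l + p.-1 * l = p * l)%N by rewrite -mulSn prednK ?prime_gt0.
  by rewrite -(eqn_modDr (p.-1 * l)) e' modnMr.
have [pkl|pkl] := boolP (p %| k + p.-1 * l)%N; rewrite -pk ?pkl ?(negPf pkl); last first.
  by rewrite sum_zetaX // !mulr0.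
have [m ->] := dvdnP pkl.
under eq_bigr => x _ do rewrite mulnC exprM (zeta_exp p_pr p_odd) expr1n.
have -> : (p * p ^ d.*2 = (p ^ d) ^ 2 * p)%N by rewrite -expnM muln2 mulnC.
by rewrite sumr_const card_Fp // -natrX -natrM mulVf // pnatr_eq0 -lt0n muln_gt0 !expn_gt0 prime_gt0.
Qed.

Lemma lam_phik w k : ~~ (p %| k)%N -> '[phik k, 'chi_(lamI w)] = 0.
Proof.
move=> pk; have k0 : (0 < k)%N by case: k pk => //; rewrite dvdn0.
rewrite cfdotE sum_heis => [|g g2]; last by rewrite phikE // (negPf g2) mul0r.
under eq_bigr => x _ do rewrite phikE // lamE /= eqxx dotr0l zeta0 rmorph1 mulr1.
by rewrite -mulr_sumr sum_zetaX // !mulr0.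
Qed.

(* If the central character is nontrivial, ['chi_i] vanishes at noncentral [g], because [g] is  *)
(* conjugate to [g z] for a central [z] with central character value different from 1; then    *)
(* ['chi_i] is proportional to [phik k] and the norms agree.                                    *)
Lemma heis_irr i : i \in @Vstar p d A \/ exists2 k, (0 < k < p)%N & 'chi_i = phik k.
Proof.
have n0 := irr1_neq0 i.
pose om (x : 'F_p) := 'chi_i (hel x 0) / 'chi_i 1%g.
have omM (g : gT) x : 'chi_i (g.1 + x, g.2) = 'chi_i g * om x.
  rewrite -irr_mul_center ?heis_center //; congr ('chi_i _).
  by rewrite heis_mulE /= bform0r !addr0.
have om0 : om 0 = 1 by rewrite /om divff.
have omD x y : om (x + y) = om x * om y.
  by rewrite {1}/om (omM (hel x 0)) mulrAC.
have [||w wP] := @Fp_char_dual p p_pr p_odd 1 (fun v => om (v 0 0)).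
- by rewrite mxE.
- by move=> u v; rewrite mxE omD.
have omE x : om x = zeta x ^+ (w 0 0).
  have := wP (const_mx x); rewrite mxE => ->.
  rewrite /dotr !mxE big_ord1 !mxE -(zetaMn p_pr p_odd); congr (zeta _).
  by rewrite -mulr_natr natr_Zp.
have [w0|w0] := eqVneq (w 0 0 : 'F_p) 0.
  left; have kerZ : heisZ A \subset cfker 'chi_i.
    apply/subsetP => -[x v]; rewrite inE /= => /eqP->.
    rewrite cfkerEchar ?irr_char // !inE /=; apply/eqP.
    rewrite -[RHS]mulr1 -(_ : om x = 1); last by rewrite omE w0.
    by rewrite mulrCA mulfV ?mulr1.
  apply/andP; split=> //; rewrite lin_irr_der1.
  rewrite derg1 gen_subG; apply: subset_trans kerZ; apply/subsetP => _ /imset2P[x y _ _ ->].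
  by rewrite inE commgEl heis_conjgE heis_mulE /= addNr.
right; exists (w 0 0 : 'F_p).
  rewrite lt0n; apply/andP; split; first by apply: contra w0 => /eqP e; apply/eqP/val_inj.
  by apply: leq_trans (ltn_ord _) _; rewrite Fp_cast.
set k := nat_of_ord (w 0 0) in omE *.
have k0 : (0 < k)%N by rewrite lt0n; apply: contra w0 => /eqP e; apply/eqP/val_inj.
have off (g : gT) : g.2 != 0 -> 'chi_i g = 0.
  move=> g2; have [j gj] := rV_neq0_coord g2.
  have [y yP] := bform_repr ((g.2 0 j * 2%:R)^-1 *: delta_mx 0 j).
  have e : 'chi_i g * om 1 = 'chi_i g.
    rewrite -omM -[in RHS](cfunJ 'chi_i g (heis_inG (hel 0 y))) heis_conjgE /= yP.
    congr ('chi_i (_ + _, _)).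
    by rewrite dotrC dotrZl dotr_delta -[RHS]mulr_natr -mulrA mulVf ?mulf_neq0 ?two_neq0.
  have om1 : om 1 != 1.
    rewrite omE zeta1_neq1 //; apply: contra w0 => pk; move: (dvdn_leq k0 pk).
    by rewrite leqNgt (leq_trans (ltn_ord _)) // Fp_cast.
  have /eqP : 'chi_i g * (om 1 - 1) = 0 by rewrite mulrBr e mulr1 subrr.
  by rewrite mulf_eq0 subr_eq0 (negPf om1) orbF => /eqP.
have cE : 'chi_i = ('chi_i 1%g / (p ^ d)%:R) *: phik k.
  apply/cfunP => -[x v]; rewrite cfunE phikE //=; case: eqP => [->|/eqP v0].
    have := omE x; rewrite /om => /(canRL (divfK n0)) ->.
    by rewrite mulrA mulfVK ?pd_neq0 // mulrC.
  by rewrite off ?mulr0.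
have c1 := cfnorm_irr i; rewrite cE cfnormZ cfdot_phik // eqxx mulr1 in c1.
have c0 : 0 <= 'chi_i 1%g / (p ^ d)%:R by rewrite divr_ge0 ?ler0n // ltW ?irr1_gt0.
move/eqP: c1; rewrite pexpr_eq1 // ger0_norm // => /eqP c1.
by rewrite cE c1 scale1r.
Qed.

Lemma phik_irr k : (0 < k < p)%N -> phik k \in irr G.
Proof.
case/andP=> k0 kp; have pk : ~~ (p %| k)%N by rewrite gtnNdvd.
have [i ik] : exists i, '[phik k, 'chi_i] != 0.
  apply/existsP; apply: contraT => /existsPn h.
  have : '[phik k] = 0.
    rewrite [X in '[X]](cfun_sum_cfdot (phik k)) big1 ?cfdot0l // => i _.
    by move: (h i); rewrite negbK => /eqP->; rewrite scale0r.
  by rewrite cfdot_phik // eqxx => /eqP; rewrite oner_eq0.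
case: (heis_irr i) ik => [/VstarP[w ->]|[l /andP[l0 lp] e]]; first by rewrite lam_phik // eqxx.
rewrite e cfdot_phik // !modn_small //; case: (k =P l) => [-> _|_]; last by rewrite eqxx.
by rewrite -e mem_irr.
Qed.

End HeisChar.

(** * From Omega_Ch(G) to U *)

Lemma Posz_prod (I : Type) (r : seq I) (P : pred I) (F : I -> nat) :
  (\prod_(i <- r | P i) F i)%N%:Z = \prod_(i <- r | P i) (F i)%:Z.
Proof. exact: (big_morph Posz PoszM (erefl _)). Qed.

Lemma dvdz_prodB (m : int) (I : Type) (r : seq I) (P : pred I) (F F' : I -> int) :
  (forall i, P i -> (m %| F i - F' i)%Z) ->
  (m %| \prod_(i <- r | P i) F i - \prod_(i <- r | P i) F' i)%Z.
Proof.
move=> h; apply: (big_ind2 (fun x y => (m %| x - y)%Z)) => // x1 x2 y1 y2 h1 h2.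
have -> : x1 * y1 - x2 * y2 = x1 * (y1 - y2) + (x1 - x2) * y2 by ring.
by apply: rpredD; [exact: dvdz_mull | exact: dvdz_mulr].
Qed.

Lemma prime_ndvd_fact p : prime p -> ~~ (p %| p.-1`!)%N.
Proof.
move=> p_pr; apply/negP => pQ; have := Wilson (prime_gt1 p_pr); rewrite p_pr -addn1 dvdn_addr //.
by rewrite dvdn1 => /esym/eqP p1; move: (prime_gt1 p_pr); rewrite p1.
Qed.

(* Pair the factors [p^(e+1) - j] and [p^(e+1) - (p - j)]: their product is [j (p - j)] modulo *)
(* [p^(e+2)], so the two sides have congruent squares.                                         *)
Lemma prod_pX_sub (p e : nat) : prime p -> odd p ->
  ((p ^ e.+2)%:Z %| \prod_(1 <= j < p) ((p ^ e.+1)%:Z - j%:Z) - (p.-1)`!%:Z)%Z.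
Proof.
move=> p_pr p_odd; set P := \prod_(1 <= j < p) _; set Q := (_`!)%:Z.
have p0 := prime_gt0 p_pr.
have QE : Q = \prod_(1 <= j < p) j%:Z.
  by rewrite /Q fact_prod prednK // Posz_prod.
have QE' : Q = \prod_(1 <= j < p) (p%:Z - j%:Z).
  rewrite QE big_nat_rev /=; rewrite big_nat [RHS]big_nat; apply: eq_bigr => j /andP[_ jp].
  by rewrite add1n subSS -subzn // ltnW.
have PE' : P = \prod_(1 <= j < p) ((p ^ e.+1)%:Z - (p%:Z - j%:Z)).
  rewrite /P big_nat_rev /=; rewrite big_nat [RHS]big_nat; apply: eq_bigr => j /andP[_ jp].
  by rewrite add1n subSS -subzn // ltnW.
have sq : ((p ^ e.+2)%:Z %| (P - Q) * (P + Q))%Z.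
  have -> : (P - Q) * (P + Q) = P * P - Q * Q by ring.
  rewrite [X in X * P - _]PE' [X in _ - X * _]QE' QE -!big_split /=.
  apply: dvdz_prodB => j _.
  have -> : ((p ^ e.+1)%:Z - (p%:Z - j%:Z)) * ((p ^ e.+1)%:Z - j%:Z) - (p%:Z - j%:Z) * j%:Z =
     (p ^ e.+1)%:Z * ((p ^ e.+1)%:Z - p%:Z) by ring.
  rewrite [(p ^ e.+2)%N]expnSr PoszM; apply: dvdz_mul => //; apply: rpredB => //.
  by rewrite expnS PoszM dvdz_mulr.
have pQ := prime_ndvd_fact p_pr.
have PQ : (p%:Z %| P - Q)%Z.
  rewrite QE'; apply: dvdz_prodB => j _; rewrite opprD opprK addrACA addNr addr0.
  by rewrite expnS PoszM rpredB ?dvdzz // dvdz_mulr.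
have cPQ : coprimez (p ^ e.+2)%:Z (P + Q).
  rewrite coprimezE /= coprime_pexpl // prime_coprime //; apply/negP => pPQ.
  have : (p %| 2 * p.-1`!)%N.
    have : (p%:Z %| (P + Q) - (P - Q))%Z by apply: rpredB.
    have -> : (P + Q) - (P - Q) = (2 * p.-1`!)%N%:Z by rewrite PoszM -/Q; ring.
    by rewrite dvdzE.
  rewrite Euclid_dvdM // (negPf pQ) orbF => pd2; have p2 := @dvdn_leq p 2 isT pd2.
  have := prime_gt1 p_pr; rewrite leq_eqVlt ltnNge p2 orbF => /eqP p2'.
  by move: p_odd; rewrite -p2'.
by move: sq; rewrite Gauss_dvdzl.
Qed.

Lemma bin_pX_p (p e : nat) : prime p -> odd p -> exists B : int,
  'C(p ^ e.+1, p)%:Z = (p ^ e)%:Z + B * (p ^ (e.+1).*2)%:Z.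
Proof.
move=> p_pr p_odd; have p0 := prime_gt0 p_pr.
set P := \prod_(1 <= j < p) ((p ^ e.+1)%:Z - j%:Z); set Q := (p.-1)`!%:Z.
have pN : (p <= p ^ e.+1)%N by rewrite expnS leq_pmulr // expn_gt0 p0.
have CQ : 'C(p ^ e.+1, p)%:Z * Q = (p ^ e)%:Z * P.
  have : 'C(p ^ e.+1, p)%:Z * (p`!)%:Z = (p ^ e.+1)%:Z * P.
    rewrite -PoszM bin_ffact ffact_prod Posz_prod.
    rewrite -(big_mkord xpredT (fun i => (p ^ e.+1 - i)%N%:Z)) big_ltn // subn0; congr (_ * _).
    rewrite big_nat [RHS]big_nat; apply: eq_bigr => j /andP[_ jp].
    by rewrite -subzn // (leq_trans (ltnW jp)).
  have pf q : (0 < q)%N -> q`! = (q * q.-1`!)%N by case: q => // q _; rewrite factS.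
  rewrite pf // expnS !PoszM -/Q => h.
  by apply: (mulfI (_ : p%:Z != 0)); [rewrite eqz_nat -lt0n | rewrite mulrCA h mulrA].
have [k kE] := dvdzP (prod_pX_sub e p_pr p_odd).
have cQ : coprimez (p ^ (e.+1).*2)%:Z Q.
  by rewrite coprimezE /= coprimeXl // prime_coprime // prime_ndvd_fact.
have : ((p ^ (e.+1).*2)%:Z %| ('C(p ^ e.+1, p)%:Z - (p ^ e)%:Z) * Q)%Z.
  rewrite mulrBl CQ -mulrBr -/P -/Q in kE *; rewrite kE.
  by rewrite mulrCA -PoszM -expnD -addnn addSnnS dvdz_mull.
rewrite Gauss_dvdzl // => /dvdzP[B BE]; exists B.
by rewrite -BE addrC subrK.
Qed.

Section OmegaU.
Variables (n p d : nat) (A : 'M['F_p]_(d.*2)).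
Hypotheses (p_pr : prime p) (p_odd : odd p) (d_gt0 : (0 < d)%N).
Hypothesis alt : forall u, bform A u u = 0.
Hypothesis ndeg : A \in unitmx.
Local Notation gT := (heis_of A).
Local Notation G := [set: heis_of A].
Local Notation Th := (Theta n p).
Local Notation ZT := (ZTh n p).
Local Notation Vs := (@Vstar p d A).
Local Notation phi := (phi_zeta A).
Local Notation lamI := (lamI A p_pr p_odd).

Lemma phiX k (g : gT) : phi (g ^+ k)%g = if g.2 *+ k == 0 then (p ^ d)%:R * zeta g.1 ^+ k else 0.
Proof. by rewrite phi_zetaE heis_expg //= (zetaMn p_pr p_odd). Qed.

Lemma cflam_phi : exists B : int, cflam p phi = 1 *+ p ^ d.-1 + sumV A *~ B.
Proof.
have [B BE] := bin_pX_p d.-1 p_pr p_odd; rewrite prednK // in BE.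
have p0 := prime_gt0 p_pr.
exists B; apply/cfunP => g.
rewrite [LHS]cfunElock -scaler_nat -scaler_int !cfunE cfun1E inE mulr1 sumVE // mulrzl.
have [g2|g2] := eqVneq g.2 0.
  rewrite (@elem_of_pw_esymp (nseq (p ^ d) (zeta g.1))) => [|i]; last first.
    by rewrite phiX g2 mul0rn eqxx big_nseq iter_addr_0 mulr_natl.
  rewrite esymp_nseq zeta_exp // mulr1 -mulrzr.
  have := congr1 (fun z : int => z%:~R : algC) BE; rewrite rmorphD rmorphM /= -!pmulrn => ->.
  by rewrite mulrC.
rewrite mul0rz addr0 elem_of_pw_lacunary // => [|i /andP[i0 ip]]; last first.
  rewrite phiX ifN //; apply: contra g2 => /eqP e; rewrite -scaler_nat in e.
  move/eqP: e; rewrite scaler_eq0 => /orP[|//].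
  by rewrite -(dvdn_pcharf (pchar_Fp p_pr)) gtnNdvd.
rewrite heis_expp // phi_zetaE eqxx zeta0 mulr1 -signr_odd.
have -> : odd p.-1 = false by move: p_odd; rewrite -{1}(prednK p0) /=; case: odd.
by rewrite mul1r -[in LHS](prednK d_gt0) expnS natrM mulKf // pnatr_eq0 -lt0n.
Qed.

Lemma phi_powp : phi ^+ p = sumV A *+ p ^ (d * (p - 2)).
Proof.
apply/cfunP => g; rewrite -scaler_nat cfunE exp_cfunE ?inE // sumVE // phi_zetaE.
case: ifP => _; last by rewrite mulr0 expr0n -leqn0 leqNgt prime_gt0.
rewrite exprMn zeta_exp // mulr1 -natrX -natrM -expnM -expnD; congr (_ ^ _)%:R.
by rewrite -muln2 -mulnDr subnK // prime_gt1.
Qed.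

Lemma phi_powk k : (0 < k)%N -> phi ^+ k = phik A k *+ p ^ (d * k.-1).
Proof.
move=> k0; apply/cfunP => g; rewrite -scaler_nat cfunE exp_cfunE ?inE // phikE // phi_zetaE.
case: ifP => _; last by rewrite mulr0 expr0n -leqn0 leqNgt k0.
rewrite exprMn mulrA; congr (_ * _).
by rewrite -natrX -natrM -expnM -expnD -mulnSr prednK.
Qed.

Lemma phi_irr : phi \in irr G.
Proof. by rewrite -phik1 phik_irr // prime_gt1. Qed.

Lemma alpha_dual (alpha : Iirr G -> Th) th : hom_Vstar alpha -> is_dual th ->
  exists v, forall i, i \in Vs -> 'chi_i (heis_lift A v) = qzexp (th (alpha i)).
Proof.
move=> hom thP.
have hD u v : qzexp (th (alpha (lamI (u + v)))) =
    qzexp (th (alpha (lamI u))) * qzexp (th (alpha (lamI v))).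
  rewrite -qzexp_thadd // -(hom _ _ (lamI (u + v))) ?lamI_Vstar //.
  by apply/cfunP => g; rewrite cfunE !lamE dotrDr zetaD.
have h0 : qzexp (th (alpha (lamI 0))) = 1.
  have /eqP := hD 0 0; rewrite addr0 -{1}[qzexp _]mulr1.
  by rewrite (inj_eq (mulfI (qzexp_neq0 p_pr p_odd _))) => /eqP.
have [v vP] := Fp_char_dual p_pr p_odd h0 hD.
exists v => i /(VstarP p_pr p_odd)[w ->].
by rewrite vP lamE dotrC.
Qed.

Lemma heis_lift_inj (v w : 'rV['F_p]_(d.*2)) :
  (forall i, i \in Vs -> 'chi_i (heis_lift A v) = 'chi_i (heis_lift A w)) -> v = w.
Proof.
move=> h; apply: dotr_eq => y; apply: (zeta_inj p_pr p_odd).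
have := h _ (lamI_Vstar A p_pr p_odd y); rewrite !lamE /=.
by rewrite dotrC [dotr w y]dotrC.
Qed.

Lemma zchar_c_alpha (alpha : Iirr G -> Th) th v :
  (forall i, i \in Vs -> 'chi_i (heis_lift A v) = qzexp (th (alpha i))) ->
  zchar (c_alpha alpha) th = if v == 0 then (p ^ d.*2)%:R else 0.
Proof.
move=> h; rewrite zchar_sum -(sumVE p_pr p_odd (heis_lift A v)) /sumV sum_cfunE.
by apply: eq_bigr => i iV; rewrite zchar_delta // h.
Qed.

Lemma eq_unit_sum (T : eqType) (s : seq T) (F : T -> algC) :
  (forall a, a \in s -> `|F a| = 1) -> `|\sum_(a <- s) F a| = (size s)%:R ->
  exists t, forall a, a \in s -> F a = t.
Proof.
case: s => [|a0 s]; first by exists 0.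
set r := a0 :: s => F1; rewrite (big_nth a0) big_mkord => e.
have F1' (i : 'I_(size r)) : xpredT i -> `|F (nth a0 r i)| = 1 by rewrite F1 ?mem_nth.
have [|t _ tP] := normC_sum_eq1 _ F1'.
  by rewrite e (eq_bigr _ F1') sumr_const card_ord.
exists t => a /(nthP a0)[i ir <-].
exact: (tP (Ordinal ir) isT).
Qed.

Lemma zchar_max_const (u : ZT) th : zN u -> deg u = (p ^ d)%:Z ->
  `|zchar u th| = (p ^ d)%:R -> exists t, forall a, a \in dom u -> qzexp (th a) = t.
Proof.
move=> uN du e; have [||t tP] := @eq_unit_sum _ (zexpand u) (fun a => qzexp (th a)).
- by move=> a _; rewrite norm_qzexp.
- rewrite -zchar_expand // e; congr _%:R; apply/eqP.
  by rewrite -eqz_nat size_zexpand // du.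
by exists t => a au; apply: tP; rewrite mem_zexpand.
Qed.

Lemma zchar_const (u : ZT) th t k : is_dual th -> zN u -> deg u = (p ^ d)%:Z ->
  (forall a, a \in dom u -> qzexp (th a) = t) ->
  zchar u (dual_nat k th) = (p ^ d)%:R * t ^+ k.
Proof.
move=> thP uN du h; rewrite zchar_dual_nat // big_seq.
under eq_bigr => a au do rewrite h // -(mulr1 (t ^+ k)) mulrA mulrAC.
rewrite -big_seq -mulr_suml; congr (_ * _).
have := deg_zchar p_pr p_odd u; rewrite du => e; rewrite -[LHS]/(\sum_(a <- dom u) _).
by rewrite pmulrn e; apply: eq_bigr => a _; rewrite qzexp_dual0 // mulr1.
Qed.
End OmegaU.

Section OmegaChU.
Variables (n p d : nat) (A : 'M['F_p]_(d.*2)).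
Hypotheses (p_pr : prime p) (p_odd : odd p) (d_gt0 : (0 < d)%N).
Hypothesis alt : forall u, bform A u u = 0.
Hypothesis ndeg : A \in unitmx.
Local Notation G := [set: heis_of A].
Local Notation Th := (Theta n p).
Local Notation ZT := (ZTh n p).
Local Notation Vs := (@Vstar p d A).
Local Notation phi := (phi_zeta A).

Section OneOmega.
Variable f : 'CF(G) -> ZT.
Hypothesis fO : OmegaCh f.

Lemma Om_add x y : x \in 'Z[irr G]%g -> y \in 'Z[irr G]%g -> f (x + y) = f x + f y.
Proof. by case: fO => h _ _ _ _; apply: h. Qed.

Lemma Om0 : f 0 = 0.
Proof.
have := Om_add (rpred0 _) (rpred0 _); rewrite addr0 => /eqP.
by rewrite -{1}[f 0]addr0 (inj_eq (addrI _)) eq_sym => /eqP.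
Qed.

Lemma Om_muln x k : x \in 'Z[irr G]%g -> f (x *+ k) = f x *+ k.
Proof.
move=> xZ; elim: k => [|k IH]; first by rewrite Om0.
by rewrite !mulrS Om_add ?IH ?rpredMn.
Qed.

Lemma Om_opp x : x \in 'Z[irr G]%g -> f (- x) = - f x.
Proof. by move=> xZ; apply/eqP; rewrite -addr_eq0 -Om_add ?rpredN // addNr Om0. Qed.

Lemma Om_mulz x (k : int) : x \in 'Z[irr G]%g -> f (x *~ k) = f x *~ k.
Proof.
move=> xZ; case: k => k; first by rewrite -!pmulrn Om_muln.
by rewrite NegzE !mulrNz -!pmulrn Om_opp ?rpredMn // Om_muln.
Qed.

Lemma Om_sum (I : Type) (r : seq I) (P : pred I) (F : I -> 'CF(G)) :
  (forall i, F i \in 'Z[irr G]%g) -> f (\sum_(i <- r | P i) F i) = \sum_(i <- r | P i) f (F i).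
Proof.
move=> FZ; elim: r => [|i r IH]; rewrite ?big_nil ?Om0 // !big_cons; case: ifP => // _.
by rewrite Om_add ?IH ?rpred_sum.
Qed.

Lemma Om_exp x k th : is_dual th -> x \in 'Z[irr G]%g ->
  zchar (f (x ^+ k)) th = zchar (f x) th ^+ k.
Proof.
move=> thP xZ; case: (fO) => _ fM f1 _ _; elim: k => [|k IH].
  by rewrite !expr0 f1 zchar_one.
by rewrite exprS fM ?rpredX // zchar_mul // IH exprS.
Qed.

Lemma Om_char chi : chi \is a character -> zN (f chi).
Proof. by case: fO => _ _ _ h _; apply: h. Qed.

Lemma Om_lin i : i \in Vs -> exists a, f 'chi_i = zdelta a.
Proof.
move=> iV; have fN := Om_char (irr_char i).
have e1 : 'chi_i ^+ p = 1.
  have [w ->] := VstarP p_pr p_odd iV; apply/cfunP => g.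
  by rewrite exp_cfunE ?inE // lamE zeta_exp // cfun1E inE.
have dg : (deg (f 'chi_i))%:~R ^+ p = 1 :> algC.
  rewrite deg_zchar // -Om_exp ?irr_vchar //; last exact: is_dual0.
  by rewrite e1; case: (fO) => _ _ -> _ _; rewrite zchar_one //; apply: is_dual0.
have sz : size (zexpand (f 'chi_i)) = 1%N.
  move: dg; rewrite -size_zexpand // -pmulrn => /eqP.
  by rewrite pexpr_eq1 ?ler0n ?prime_gt0 // pnatr_eq1 => /eqP.
case E : (zexpand (f 'chi_i)) sz => [|a [|]] // _; exists a.
by apply: zchar_inj => // th thP; rewrite zchar_expand // E big_seq1 zchar_delta.
Qed.

Variable alpha : Iirr G -> Th.
Hypothesis falpha : forall i, i \in Vs -> f 'chi_i = zdelta (alpha i).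

Lemma Om_hom : hom_Vstar alpha.
Proof.
move=> i j k iV jV kV e; apply: theta_eqP => // th thP.
rewrite qzexp_thadd // -(zchar_delta (alpha k)) -(zchar_delta (alpha i)) -(zchar_delta (alpha j)) -!falpha // e.
by case: (fO) => _ fM _ _ _; rewrite fM ?irr_vchar // zchar_mul.
Qed.

Lemma Om_sumV th : zchar (f (sumV A)) th = zchar (c_alpha alpha) th.
Proof.
rewrite /sumV Om_sum => [|i]; last exact: irr_vchar.
by congr (zchar _ th); apply: eq_bigr => i iV; rewrite falpha.
Qed.

Lemma sumV_vchar : sumV A \in 'Z[irr G]%g.
Proof. by apply: rpred_sum => i _; apply: irr_vchar. Qed.

Lemma phi_char : phi \is a character.
Proof. by have /irrP[i ->] := phi_irr p_pr p_odd alt ndeg; apply: irr_char. Qed.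

Lemma phi_vchar : phi \in 'Z[irr G]%g.
Proof. exact/char_vchar/phi_char. Qed.

Lemma Om_phi_powp th v : is_dual th ->
  (forall i, i \in Vs -> 'chi_i (heis_lift A v) = qzexp (th (alpha i))) ->
  zchar (f phi) th ^+ p = if v == 0 then (p ^ d)%:R ^+ p else 0.
Proof.
move=> thP vP; rewrite -Om_exp ?phi_vchar // phi_powp // Om_muln ?sumV_vchar //.
rewrite zcharMn // Om_sumV (zchar_c_alpha p_pr p_odd vP); case: ifP => _; last by rewrite mul0rn.
rewrite -natrX -mulrnA -!expnM -expnD; congr (_ ^ _)%:R.
by rewrite -muln2 -mulnDr addnC subnK // prime_gt1.
Qed.

Lemma Om_phi_deg : deg (f phi) = (p ^ d)%:Z.
Proof.
have := @Om_phi_powp (@dual0 n p) 0 (is_dual0 p_pr p_odd) _; rewrite eqxx => /(_ _)/eqP.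
rewrite -deg_zchar // -size_zexpand ?Om_char ?phi_char // -pmulrn eqrXn2 ?ler0n ?prime_gt0 //.
rewrite eqr_nat => h; apply/eqP; rewrite eqz_nat; apply: h.
move=> i /(VstarP p_pr p_odd)[w ->].
by rewrite qzexp_dual0 // lamE /= dotr0l zeta0.
Qed.

Lemma Om_phi_const th v : is_dual th ->
  (forall i, i \in Vs -> 'chi_i (heis_lift A v) = qzexp (th (alpha i))) ->
  v = 0 -> exists2 t, t ^+ p = 1 & forall a, a \in dom (f phi) -> qzexp (th a) = t.
Proof.
move=> thP vP v0; have uN := Om_char phi_char; have du := Om_phi_deg.
have e := Om_phi_powp thP vP; rewrite v0 eqxx in e.
have e1 : `|zchar (f phi) th| = (p ^ d)%:R.
  apply/eqP; rewrite -(eqrXn2 (prime_gt0 p_pr)) ?normr_ge0 ?ler0n // -normrX e.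
  by rewrite ger0_norm ?exprn_ge0 ?ler0n.
have [t tP] := zchar_max_const p_pr p_odd uN du e1.
exists t => //; have := zchar_const p_pr p_odd 1 thP uN du tP.
rewrite zchar_dual_nat1 // expr1 => e2; move: e; rewrite e2 exprMn => /eqP.
rewrite -subr_eq0 -{2}[(p ^ d)%:R ^+ p]mulr1 -mulrBr mulf_eq0 subr_eq0.
by rewrite expf_eq0 (negPf (pd_neq0 _ p_pr)) andbF => /eqP.
Qed.

Lemma Om_phi_zero th v : is_dual th ->
  (forall i, i \in Vs -> 'chi_i (heis_lift A v) = qzexp (th (alpha i))) ->
  v != 0 -> zchar (f phi) th = 0.
Proof.
move=> thP vP v0; have /eqP := Om_phi_powp thP vP.
by rewrite (negPf v0) expf_eq0 => /andP[_ /eqP].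
Qed.

Lemma dual_nat_lift th v k :
  (forall i, i \in Vs -> 'chi_i (heis_lift A v) = qzexp (th (alpha i))) ->
  forall i, i \in Vs -> 'chi_i (heis_lift A (v *+ k)) = qzexp (dual_nat k th (alpha i)).
Proof.
move=> vP i iV; rewrite qzexp_dual_nat // -vP //.
have [w ->] := VstarP p_pr p_odd iV; rewrite !lamE /= -(zetaMn p_pr p_odd); congr (zeta _).
by rewrite -scaler_nat dotrZl mulr_natl.
Qed.

(* Off the kernel of the dual of [alpha] the power sums of [f phi] of index [0 < i < p] vanish, so *)
(* [lambda^p] computes the [p]-th power sum; it must equal [p^d], the degree.                     *)
Lemma Om_phi_tors : all (@th_tors n p) (dom (f phi)).
Proof.
apply/allP => a au; apply: th_torsP => // th thP.
have uN := Om_char phi_char; have du := Om_phi_deg.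
have [v vP] := alpha_dual p_pr p_odd Om_hom thP.
have [v0|v0] := eqVneq v 0.
  by have [t tp ->] := Om_phi_const thP vP v0.
have p0 := prime_gt0 p_pr.
have [B BE] := cflam_phi p_pr p_odd d_gt0 alt.
case: (fO) => _ _ f1 _ fL; have := congr1 (fun x => zchar x th) (fL _ p phi_char).
rewrite BE Om_add ?rpredMn ?rpred1 ?rpredMz ?sumV_vchar // Om_muln ?rpred1 //.
rewrite Om_mulz ?sumV_vchar // f1 zcharD // zcharMn // zcharMz // zchar_one //.
rewrite Om_sumV (zchar_c_alpha p_pr p_odd vP) (negPf v0) mulr0 addr0 zchar_lam //.
rewrite elem_of_pw_lacunary // => [|i /andP[i0 ip]]; last first.
  apply: (Om_phi_zero (is_dual_nat p_pr p_odd i thP) (dual_nat_lift i vP)).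
  apply: contra v0; rewrite -scaler_nat scaler_eq0 => /orP[|//].
  by rewrite -(dvdn_pcharf (pchar_Fp p_pr)) gtnNdvd.
rewrite -signr_odd; have -> : odd p.-1 = false by move: p_odd; rewrite -{1}(prednK p0) /=; case: odd.
rewrite mul1r zchar_dual_nat // => e0.
have pn0 : p%:R != 0 :> algC by rewrite pnatr_eq0 -lt0n.
have e : \sum_(b <- zexpand (f phi)) qzexp (th b) ^+ p = (p ^ d)%:R.
  rewrite sum_zexpand //; apply: (mulfI (invr_neq0 pn0)); rewrite -e0.
  by rewrite -[in RHS](prednK d_gt0) expnS natrM mulKf.
have szu : size (zexpand (f phi)) = (p ^ d)%N.
  by apply/eqP; rewrite -eqz_nat size_zexpand // du.
have [||t tP] := @eq_unit_sum _ (zexpand (f phi)) (fun b => qzexp (th b) ^+ p).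
- by move=> b _; rewrite normrX norm_qzexp // expr1n.
- by rewrite e szu ger0_norm ?ler0n.
have au' : a \in zexpand (f phi) by rewrite mem_zexpand.
rewrite tP //; move: e; rewrite big_seq.
under eq_bigr => b bu do rewrite tP //.
rewrite -big_seq big_const_seq count_predT iter_addr_0 szu -[t *+ _]mulr_natr => e1.
by apply: (mulIf (pd_neq0 d p_pr)); rewrite e1 mul1r.
Qed.

Lemma Om_in_U : in_U alpha (f phi).
Proof.
have uN := Om_char phi_char; have du := Om_phi_deg.
split=> //; [exact: Om_hom|exact: Om_phi_tors|].
apply: zchar_inj => // th thP; rewrite zchar_mul // zchar_psi //.
have [v vP] := alpha_dual p_pr p_odd Om_hom thP.
rewrite (zchar_c_alpha p_pr p_odd vP); case: eqP => [v0|/eqP v0]; last first.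
  by rewrite (Om_phi_zero thP vP v0) mul0r.
have [t tp tP] := Om_phi_const thP vP v0.
have z1 := zchar_const p_pr p_odd 1 thP uN du tP.
have zp := zchar_const p_pr p_odd p.-1 thP uN du tP.
rewrite -zchar_dual_nat1 // z1 -zchar_dual_nat // zp mulrACA -exprD add1n prednK ?prime_gt0 // tp mulr1.
by rewrite -natrM -expnD addnn.
Qed.

Lemma Om_phik k th : is_dual th -> (0 < k < p)%N ->
  zchar (f (phik A k)) th *+ p ^ (d * k.-1) = zchar (f phi) th ^+ k.
Proof.
move=> thP /andP[k0 kp]; rewrite -Om_exp ?phi_vchar // phi_powk // Om_muln ?zcharMn //.
by have /irrP[i ->] := phik_irr p_pr p_odd alt ndeg (introT andP (conj k0 kp)); apply: irr_vchar.
Qed.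
End OneOmega.

Lemma Om_inj (f g : 'CF(G) -> ZT) alpha u : OmegaCh f -> OmegaCh g ->
  restr f alpha u -> restr g alpha u -> {in 'Z[irr G]%g, f =1 g}.
Proof.
move=> fO gO [fa fu] [ga gu] x xZ.
have irrE i : f 'chi_i = g 'chi_i.
  case: (heis_irr p_pr p_odd alt ndeg i) => [iV|[k kp ->]]; first by rewrite fa ?ga.
  apply: zchar_inj => // th thP.
  have := Om_phik fO thP kp; have := Om_phik gO thP kp; rewrite -fu -gu => <- /eqP.
  rewrite -subr_eq0 -mulrnBl mulrn_eq0 subr_eq0 expn_eq0.
  by rewrite -[p == 0]negbK -lt0n prime_gt0 // => /eqP.
have xE : x = \sum_i 'chi_i *~ Num.floor '[x, 'chi_i].
  rewrite {1}[x]cfun_sum_cfdot; apply: eq_bigr => i _.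
  by rewrite -scaler_int floorK // Cint_cfdot_vchar_irr.
rewrite xE !Om_sum // => [|i|i]; try by rewrite rpredMz ?irr_vchar.
by apply: eq_bigr => i _; rewrite !Om_mulz ?irr_vchar // irrE.
Qed.

Lemma Om_to_U (f : 'CF(G) -> ZT) : OmegaCh f ->
  exists (alpha : Iirr G -> Th) (u : ZT), restr f alpha u /\ in_U alpha u.
Proof.
move=> fO; pose alpha i := head (th0 n p) (dom (f 'chi_i)).
have fa i : i \in Vs -> f 'chi_i = zdelta (alpha i).
  by move=> iV; have [a fE] := Om_lin fO iV; rewrite /alpha fE domU1.
by exists alpha, (f phi); split=> //; apply: Om_in_U.
Qed.
End OmegaChU.

(** * From U to Omega_Ch(G) *)

Section FromPoints.
Variables (n p d : nat) (A : 'M['F_p]_(d.*2)).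
Hypotheses (p_pr : prime p) (p_odd : odd p).
Local Notation gT := (heis_of A).
Local Notation G := [set: heis_of A].
Local Notation Th := (Theta n p).
Local Notation ZT := (ZTh n p).

Variable g : (Th -> QZp p) -> gT.

Definition pt_rel (x : 'CF(G)) (y : ZT) := forall th, is_dual th -> zchar y th = x (g th).

(* Choosing a preimage for every class function, not only for virtual characters, spares the proof *)
(* that [cflam k chi] is a character.                                                            *)
Definition pt_hom (x : 'CF(G)) : ZT := epsilon (inhabits 0) (pt_rel x).

Lemma pt_hom_rel x : (exists y, pt_rel x y) -> pt_rel x (pt_hom x).
Proof. exact: epsilon_spec. Qed.

Lemma pt_hom_eq x y : pt_rel x y -> pt_hom x = y.
Proof.
move=> xy; have h := pt_hom_rel (ex_intro _ y xy).
by apply: zchar_inj => // th thP; rewrite h // xy.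
Qed.

Hypothesis g_irr : forall i, exists2 y, zN y & pt_rel 'chi_i y.
Hypothesis g_nat : forall k th, is_dual th -> g (dual_nat k th) = (g th ^+ k)%g.

Lemma pt_hom_kappa : is_kappa g pt_hom.
Proof.
move=> x xZ; apply: pt_hom_rel.
exists (\sum_i pt_hom 'chi_i *~ Num.floor '[x, 'chi_i]) => th thP.
rewrite zchar_sum {2}[x]cfun_sum_cfdot sum_cfunE; apply: eq_bigr => i _.
rewrite zcharMz cfunE floorK ?Cint_cfdot_vchar_irr //.
by have [y _ yP] := g_irr i; rewrite (pt_hom_eq yP) yP.
Qed.

Lemma pt_hom_char chi : chi \is a character -> zN (pt_hom chi).
Proof.
move=> chiC; have cN i := Cnat_cfdot_char_irr i chiC.
rewrite (@pt_hom_eq _ (\sum_i pt_hom 'chi_i *+ Num.trunc '[chi, 'chi_i])); last first.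
  move=> th thP; rewrite zchar_sum {2}[chi]cfun_sum_cfdot sum_cfunE; apply: eq_bigr => i _.
  rewrite zcharMn cfunE -{2}(truncnK (cN i)) mulr_natl; congr (_ *+ _).
  by have [y _ yP] := g_irr i; rewrite (pt_hom_eq yP) yP.
apply: zN_sum => i _; apply: zN_muln.
by have [y yN yP] := g_irr i; rewrite (pt_hom_eq yP).
Qed.

Lemma pt_hom_Omega : OmegaCh pt_hom.
Proof.
split.
- move=> x y xZ yZ; apply: pt_hom_eq => th thP.
  by rewrite zcharD !pt_hom_kappa // cfunE.
- move=> x y xZ yZ; apply: pt_hom_eq => th thP.
  by rewrite zchar_mul // !pt_hom_kappa // cfunE.
- by apply: pt_hom_eq => th thP; rewrite zchar_one // cfun1E inE.
- exact: pt_hom_char.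
move=> chi k chiC; apply: pt_hom_eq => th thP.
rewrite zchar_lam ?pt_hom_char // cfunElock /elem_of_pw; congr nth; apply: eq_newton_seq => i.
by rewrite pt_hom_kappa ?char_vchar ?g_nat //; apply: is_dual_nat.
Qed.
End FromPoints.

Section FromU.
Variables (n p d : nat) (A : 'M['F_p]_(d.*2)).
Hypotheses (p_pr : prime p) (p_odd : odd p).
Hypothesis alt : forall u, bform A u u = 0.
Hypothesis ndeg : A \in unitmx.
Local Notation gT := (heis_of A).
Local Notation G := [set: heis_of A].
Local Notation Th := (Theta n p).
Local Notation ZT := (ZTh n p).
Local Notation Vs := (@Vstar p d A).
Local Notation phi := (phi_zeta A).

Variables (alpha : Iirr G -> Th) (u : ZT).
Hypothesis U : in_U alpha u.

Let a0 := head (th0 n p) (dom u).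

Lemma U_a0 : a0 \in dom u.
Proof.
rewrite /a0; case E: (dom u) => [|a s]; last by rewrite mem_head.
have /eqP u0 : u == 0 by rewrite -dom_eq0 E.
case: U => _ _ du _ _; move: du; rewrite u0 deg0 => /eqP.
by rewrite eqz_nat eq_sym expn_eq0 -[p == 0]negbK -lt0n prime_gt0.
Qed.

Definition U_spec (th : Th -> QZp p) (h : gT) :=
  zeta h.1 = qzexp (th a0) /\
  forall i, i \in Vs -> 'chi_i (heis_lift A h.2) = qzexp (th (alpha i)).

Definition U_pt (th : Th -> QZp p) : gT := epsilon (inhabits 1%g) (U_spec th).

Lemma U_tors th a : is_dual th -> a \in dom u -> qzexp (th a) ^+ p = 1.
Proof.
by case: U => _ _ _ /allP tors _ thP au; apply: (qzexp_tors p_pr p_odd thP (tors _ au)).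
Qed.

Lemma U_ptP th : is_dual th -> U_spec th (U_pt th).
Proof.
move=> thP; apply: epsilon_spec; case: (U) => hom _ _ _ _.
have [v vP] := alpha_dual p_pr p_odd hom thP.
have [x /eqP xP] := zeta_surj p_pr p_odd (U_tors thP U_a0).
by exists (x, v).
Qed.

Lemma U_pt_unique th h h' : U_spec th h -> U_spec th h' -> h = h'.
Proof.
case: h h' => [x v] [x' v'] [/= hx hv] [/= hx' hv']; congr (_, _).
  by apply: (zeta_inj p_pr p_odd); rewrite hx hx'.
by apply: (heis_lift_inj p_pr p_odd) => i iV; exact: etrans (hv i iV) (esym (hv' i iV)).
Qed.

Lemma chi_liftD i v w : i \in Vs ->
  'chi_i (heis_lift A (v + w)) = 'chi_i (heis_lift A v) * 'chi_i (heis_lift A w).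
Proof. by case/(VstarP p_pr p_odd) => y ->; rewrite !lamE /= dotrDl zetaD. Qed.

Lemma U_pt_add th th' : is_dual th -> is_dual th' ->
  U_pt (dual_add th th') = ((U_pt th).1 + (U_pt th').1, (U_pt th).2 + (U_pt th').2).
Proof.
move=> thP thP'; have [x v] := U_ptP thP; have [x' v'] := U_ptP thP'.
apply: (U_pt_unique (U_ptP (is_dual_add p_pr p_odd thP thP'))); split=> [|i iV] /=.
  by rewrite zetaD // x x' qzexp_dual_add.
by rewrite chi_liftD // v // v' // qzexp_dual_add.
Qed.

Lemma U_pt_nat k th : is_dual th -> U_pt (dual_nat k th) = (U_pt th ^+ k)%g.
Proof.
move=> thP; have [x v] := U_ptP thP; rewrite heis_expg //.
apply: (U_pt_unique (U_ptP (is_dual_nat p_pr p_odd k thP))); split=> [|i iV] /=.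
  by rewrite zetaMn // x qzexp_dual_nat.
exact: (dual_nat_lift p_pr p_odd k v iV).
Qed.

Lemma U_pt_phi th : is_dual th -> zchar u th = phi (U_pt th).
Proof.
move=> thP; have [x v] := U_ptP thP; case: (U) => hom uN du tors uu.
have cu : zchar (zpsi p.-1 u) th = (zchar u th)^*.
  rewrite zchar_psi // /zchar rmorph_sum big_seq [RHS]big_seq; apply: eq_bigr => a au /=.
  rewrite rmorphM /= rmorph_int; congr (_ * _).
  apply: (mulfI (qzexp_neq0 p_pr p_odd (th a))).
  by rewrite -exprS prednK ?prime_gt0 // U_tors // -normCK norm_qzexp // expr1n.
have := congr1 (fun z => zchar z th) uu; rewrite zchar_mul // cu -normCK.
rewrite (zchar_c_alpha p_pr p_odd v) phi_zetaE; case: eqP => [v0|/eqP v0] /eqP; last first.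
  by rewrite expf_eq0 normr_eq0 => /eqP.
have -> : (p ^ d.*2)%:R = (p ^ d)%:R ^+ 2 :> algC by rewrite -natrX -expnM muln2.
rewrite eqrXn2 ?normr_ge0 ?ler0n // => /eqP e.
have [t tP] := zchar_max_const p_pr p_odd uN du e.
have := zchar_const p_pr p_odd 1 thP uN du tP.
by rewrite zchar_dual_nat1 // expr1 => ->; rewrite x (tP _ U_a0).
Qed.

Lemma U_pt_Vs i : i \in Vs -> pt_rel U_pt 'chi_i (zdelta (alpha i)).
Proof.
move=> iV th thP; have [_ v] := U_ptP thP; rewrite zchar_delta -v //.
by case/(VstarP p_pr p_odd): iV => w ->; rewrite !lamE.
Qed.

Lemma U_pt_irr i : exists2 y, zN y & pt_rel U_pt 'chi_i y.
Proof.
case: (heis_irr p_pr p_odd alt ndeg i) => [iV|[k /andP[k0 kp] ->]].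
  by exists (zdelta (alpha i)); [apply: zN_delta | apply: U_pt_Vs].
case: (U) => _ uN _ _ _; exists (zpsi k u); first exact: zN_psi.
move=> th thP; rewrite zchar_psi // -zchar_dual_nat // U_pt_phi; last exact: is_dual_nat.
rewrite U_pt_nat // phiX // phikE //; congr (if _ then _ else _).
rewrite -scaler_nat scaler_eq0 -(dvdn_pcharf (pchar_Fp p_pr)) gtnNdvd //.
Qed.

Lemma U_surj : exists f, OmegaCh f /\ restr f alpha u.
Proof.
exists (pt_hom U_pt); split.
  by apply: pt_hom_Omega => //; [exact: U_pt_irr | move=> k th; apply: U_pt_nat].
split=> [i iV|]; first by apply: pt_hom_eq => //; apply: U_pt_Vs.
by apply/esym/pt_hom_eq => //; apply: U_pt_phi.
Qed.

Lemma U_pt_hom : img_dual_isotropic alpha -> hom_dual U_pt.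
Proof.
move=> iso th th' thP thP'; rewrite U_pt_add // heis_mulE.
by rewrite iso ?addr0 //; [exists th | exists th']; split=> //;
  [case: (U_ptP thP) | case: (U_ptP thP')].
Qed.
End FromU.

(** * Restriction along homomorphisms from Theta^* *)

Section TorsionDual.
Variables (n p : nat).
Hypotheses (p_pr : prime p) (p_odd : odd p).
Local Notation Th := (Theta n p).
Local Notation qzI := (qzexp_inj p_pr p_odd).

Lemma zeta_nat_exp (x : 'F_p) : zeta x = zeta (1 : 'F_p) ^+ x.
Proof. by rewrite -zetaMn // natr_Zp. Qed.

Lemma theta_coord_eq (a b : Th) : (forall i, qzexp (a i) = qzexp (b i)) -> a = b.
Proof. by move=> h; apply/ffunP => i; apply: qzI. Qed.

Lemma qzexp_coordD (a b : Th) i : qzexp (thadd a b i) = qzexp (a i) * qzexp (b i).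
Proof. exact: (qzexp_thadd p_pr p_odd (@is_dual_coord n p i)). Qed.

Lemma qzexp_coord_nat (a : Th) k i : qzexp (thnat k a i) = qzexp (a i) ^+ k.
Proof. exact: (qzexp_thnat p_pr p_odd (@is_dual_coord n p i)). Qed.

Lemma qzexp_coord_sum (I : finType) (P : pred I) (F : I -> Th) i :
  qzexp ((\big[@thadd n p/th0 n p]_(j | P j) F j) i) = \prod_(j | P j) qzexp (F j i).
Proof. exact: (qzexp_thsum p_pr p_odd (@is_dual_coord n p i)). Qed.

Definition th_of_roots (z : 'I_n -> algC) : Th :=
  [ffun i => epsilon (inhabits (qz0 p)) (fun x => qzexp x = z i)].

Lemma th_of_rootsE z i : (exists x : QZp p, qzexp x = z i) -> qzexp (th_of_roots z i) = z i.
Proof. by rewrite ffunE => /(epsilon_spec (inhabits (qz0 p))). Qed.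

Definition th_tors_of (w : 'rV['F_p]_n) : Th := th_of_roots (fun i => zeta (w 0 i)).

Lemma th_tors_ofE w i : qzexp (th_tors_of w i) = zeta (w 0 i).
Proof.
apply: th_of_rootsE; have [x /eqP xE] := qz_root p_pr p_odd (zeta_exp p_pr p_odd (w 0 i)).
by exists x.
Qed.

Lemma th_tors_of_tors w : th_tors (th_tors_of w).
Proof.
apply/eqP/theta_coord_eq => i.
by rewrite qzexp_coord_nat th_tors_ofE zeta_exp // ffunE qzexp0.
Qed.

Definition th_basis i := th_tors_of (delta_mx 0 i).

Definition dual_vec (th : Th -> QZp p) : 'rV['F_p]_n :=
  epsilon (inhabits 0) (fun k : 'rV_n => forall i, zeta (k 0 i) = qzexp (th (th_basis i))).

Lemma dual_vecE th i : is_dual th -> zeta (dual_vec th 0 i) = qzexp (th (th_basis i)).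
Proof.
move=> thP; apply: (epsilon_spec (inhabits 0)
  (fun k : 'rV_n => forall i, zeta (k 0 i) = qzexp (th (th_basis i)))).
have ex j := zeta_surj p_pr p_odd (qzexp_tors p_pr p_odd thP (th_tors_of_tors (delta_mx 0 j))).
exists (\row_j xchoose (ex j)) => j; rewrite mxE.
by rewrite -(eqP (xchooseP (ex j))).
Qed.

Lemma dual_vec_tors th w : is_dual th -> qzexp (th (th_tors_of w)) = zeta (dotr (dual_vec th) w).
Proof.
move=> thP.
have -> : th_tors_of w = \big[@thadd n p/th0 n p]_j thnat (w 0 j) (th_basis j).
  apply: theta_coord_eq => i; rewrite qzexp_coord_sum (bigD1 i) //= big1 ?mulr1 => [|j ji].
    by rewrite qzexp_coord_nat !th_tors_ofE mxE !eqxx -zeta_nat_exp.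
  by rewrite qzexp_coord_nat th_tors_ofE mxE eqxx eq_sym (negPf ji) zeta0 expr1n.
rewrite qzexp_thsum // /dotr mxE (big_morph _ (zetaD p_pr p_odd) (zeta0 p)).
apply: eq_bigr => j _; rewrite qzexp_thnat // -dual_vecE // -zetaMn // mxE.
by rewrite -mulr_natr natr_Zp.
Qed.

Lemma dual_vec_eq th k : is_dual th ->
  (forall w, qzexp (th (th_tors_of w)) = zeta (dotr k w)) -> dual_vec th = k.
Proof.
move=> thP h; apply: dotr_eq => w; apply: (zeta_inj p_pr p_odd).
by rewrite ![dotr w _]dotrC -dual_vec_tors // h.
Qed.

Lemma dual_vec_add th th' : is_dual th -> is_dual th' ->
  dual_vec (dual_add th th') = dual_vec th + dual_vec th'.
Proof.
move=> h h'; apply: dual_vec_eq => [|w]; first exact: is_dual_add.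
by rewrite qzexp_dual_add // !dual_vec_tors // dotrDl zetaD.
Qed.

Definition dual_comb (k : 'rV['F_p]_n) : Th -> QZp p :=
  fun a => \big[@qzadd p/qz0 p]_i dual_nat (k 0 i) (dual_coord i) a.

Lemma dual_combE k a : qzexp (dual_comb k a) = \prod_i qzexp (a i) ^+ (k 0 i).
Proof.
rewrite /dual_comb (big_morph _ (qzexpD p_pr p_odd) (qzexp0 p_pr p_odd)).
by apply: eq_bigr => i _; rewrite qzexp_dual_nat.
Qed.

Lemma is_dual_comb k : is_dual (dual_comb k).
Proof.
apply/(is_dualP p_pr p_odd) => a b; rewrite !dual_combE -big_split.
by apply: eq_bigr => i _; rewrite qzexp_coordD exprMn.
Qed.

Lemma dual_vec_comb k : dual_vec (dual_comb k) = k.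
Proof.
apply: dual_vec_eq => [|w]; first exact: is_dual_comb.
rewrite dual_combE /dotr mxE (big_morph _ (zetaD p_pr p_odd) (zeta0 p)).
apply: eq_bigr => i _; rewrite th_tors_ofE -zetaMn // mxE -mulr_natr natr_Zp.
by rewrite mulrC.
Qed.

Lemma tors_th_tors_of (a : Th) : (forall i, qzexp (a i) ^+ p = 1) -> exists w, a = th_tors_of w.
Proof.
move=> tors; have ex i := zeta_surj p_pr p_odd (tors i).
exists (\row_i xchoose (ex i)); apply: theta_coord_eq => i.
by rewrite th_tors_ofE mxE -(eqP (xchooseP (ex i))).
Qed.

Lemma th_inv (a : Th) : exists a' : Th, forall i, qzexp (a' i) = (qzexp (a i))^-1.
Proof.
exists (th_of_roots (fun i => (qzexp (a i))^-1)) => i; apply: th_of_rootsE.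
have [k /(_ k (leqnn k))[c ck cE]] := qz_rep p_pr (a i).
exists (mkqz p k (p ^ k - c)); rewrite qzexp_mkqz // (qzexpE p_pr p_odd cE).
have e0 : eprim p k ^+ c != 0 by rewrite -(qzexpE p_pr p_odd cE) qzexp_neq0.
apply: (mulIf e0); rewrite mulVf // -exprD subnK ?(ltnW ck) //.
exact: prim_expr_order (eprim_prim p_pr p_odd k).
Qed.

(* Duals vanishing on the [p]-torsion are divisible by [p]: divide the argument instead. *)
Lemma dual_div th : is_dual th -> dual_vec th = 0 ->
  exists2 th', is_dual th' & th = dual_nat p th'.
Proof.
move=> thP v0.
have tors1 (t : Th) : (forall i, qzexp (t i) ^+ p = 1) -> qzexp (th t) = 1.
  by move=> /tors_th_tors_of[w ->]; rewrite dual_vec_tors // v0 dotr0l zeta0.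
have indep (a b : Th) : (forall i, qzexp (a i) ^+ p = qzexp (b i) ^+ p) -> qzexp (th a) = qzexp (th b).
  move=> ab; have [b' b'E] := th_inv b.
  have -> : a = thadd (thadd a b') b.
    by apply: theta_coord_eq => i; rewrite !qzexp_coordD b'E mulfVK // qzexp_neq0.
  rewrite qzexp_thadd // tors1 ?mul1r // => i.
  by rewrite qzexp_coordD b'E exprMn ab -exprMn mulfV ?expr1n // qzexp_neq0.
pose dv (a : Th) : Th := th_of_roots (fun i => epsilon (inhabits 0)
  (fun z => z ^+ p = qzexp (a i) /\ exists x : QZp p, qzexp x = z)).
have dvE a i : qzexp (dv a i) ^+ p = qzexp (a i).
  have [|e1 e2] := epsilon_spec (inhabits 0)
    (fun z => z ^+ p = qzexp (a i) /\ exists x : QZp p, qzexp x = z).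
    by have [y /eqP yE] := qz_div p_pr p_odd (a i); exists (qzexp y); split=> //; exists y.
  by rewrite th_of_rootsE.
exists (th \o dv); first apply/(is_dualP p_pr p_odd) => a b /=.
  rewrite -qzexp_thadd //; apply: indep => i.
  by rewrite qzexp_coordD exprMn !dvE qzexp_coordD.
apply: functional_extensionality => a; apply: qzI; rewrite qzexp_dual_nat //=.
rewrite -qzexp_thnat //; apply: (congr1 (fun t => qzexp (th t))); apply: theta_coord_eq => i.
by rewrite qzexp_coord_nat dvE.
Qed.
End TorsionDual.

Section Kappa.
Variables (n p d : nat) (A : 'M['F_p]_(d.*2)).
Hypotheses (p_pr : prime p) (p_odd : odd p).
Hypothesis alt : forall u, bform A u u = 0.
Hypothesis ndeg : A \in unitmx.
Local Notation gT := (heis_of A).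
Local Notation Th := (Theta n p).

Section OneMu.
Variable mu : (Th -> QZp p) -> gT.
Hypothesis mu_hom : hom_dual mu.

Lemma mu_dual0 : mu (@dual0 n p) = 1%g.
Proof.
have d0 := @is_dual0 n p p_pr p_odd.
have := mu_hom d0 d0; have -> : dual_add (@dual0 n p) (@dual0 n p) = @dual0 n p.
  by apply: functional_extensionality => a; apply: (qzexp_inj p_pr p_odd);
    rewrite qzexp_dual_add // qzexp_dual0 // mulr1.
by move/esym/(canRL (mulKg _)); rewrite mulVg.
Qed.

Lemma mu_nat k th : is_dual th -> mu (dual_nat k th) = (mu th ^+ k)%g.
Proof.
move=> thP; elim: k => [|k IH]; first exact: mu_dual0.
rewrite expgS -IH -mu_hom //; exact: is_dual_nat.
Qed.

Lemma mu_dual_vec th th' : is_dual th -> is_dual th' -> dual_vec th = dual_vec th' ->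
  mu th = mu th'.
Proof.
move=> thP thP' e; have nP := is_dual_nat p_pr p_odd p.-1 thP'.
have dv_nat k : dual_vec (dual_nat k th') = dual_vec th' *+ k.
  elim: k => [|k IH].
    apply: dual_vec_eq => // [|w]; first exact: is_dual0.
    by rewrite qzexp_dual0 // mulr0n dotr0l zeta0.
  rewrite mulrS -IH -dual_vec_add //; exact: is_dual_nat.
have [|th'' thP'' E] := dual_div p_pr p_odd (is_dual_add p_pr p_odd thP nP).
  rewrite dual_vec_add // e dv_nat -mulrS prednK ?prime_gt0 //.
  by rewrite -scaler_nat pchar_Fp_0 // scale0r.
have := mu_hom thP nP; rewrite E !mu_nat // heis_expp // => /esym/(canRL (mulgK _)) ->.
apply: (mulIg ((mu th' ^+ p.-1)%g)).
by rewrite mul1g mulVg -expgS prednK ?prime_gt0 // heis_expp.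
Qed.

Definition mu_vec (k : 'rV['F_p]_n) : gT := mu (dual_comb k).

Lemma mu_vecE th : is_dual th -> mu th = mu_vec (dual_vec th).
Proof.
by move=> thP; apply: mu_dual_vec; rewrite ?dual_vec_comb //; apply: is_dual_comb.
Qed.

Lemma mu_vecD k l : mu_vec (k + l) = (mu_vec k * mu_vec l)%g.
Proof.
have h := @is_dual_comb n p p_pr p_odd.
rewrite /mu_vec -mu_hom //; apply: mu_dual_vec => //; first exact: is_dual_add.
by rewrite dual_vec_add // !dual_vec_comb.
Qed.

Lemma mu_irr i : exists2 y, zN y & pt_rel mu 'chi_i y.
Proof.
have /char_reprP[rG chiE] := irr_char i.
pose W := [set: 'rV['F_p]_n].
have reprW : mx_repr W (fun k => rG (mu_vec k)).
  split=> [|k l _ _]; last by rewrite FinRing.zmodMgE mu_vecD repr_mxM ?inE.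
  have m1 : mu_vec 0 = 1%g.
    by have := mu_vecD 0 0; rewrite addr0 => /esym/(canRL (mulKg _)); rewrite mulVg.
  by rewrite FinRing.zmod1gE m1 repr_mx1.
pose psi := cfRepr (MxRepresentation reprW).
have psiC : psi \is a character by apply: cfRepr_char.
have psiE k : psi k = 'chi_i (mu_vec k) by rewrite chiE !cfunE !inE.
have abW : abelian W.
  by apply/centsP => k _ l _; rewrite /commute !FinRing.zmodMgE addrC.
have lin j : exists w, forall k, 'chi[W]_j k = zeta (dotr k w).
  have jl : 'chi_j \is a linear_char by apply/char_abelianP.
  apply: Fp_char_dual => //; first by have := lin_char1 jl; rewrite FinRing.zmod1gE.
  by move=> k l; rewrite -(lin_charM jl) ?inE // FinRing.zmodMgE.
pose w j := epsilon (inhabits 0) (fun w => forall k, 'chi[W]_j k = zeta (dotr k w)).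
have wE j k : 'chi[W]_j k = zeta (dotr k (w j)).
  exact: (epsilon_spec (inhabits 0) (fun w => forall k, 'chi[W]_j k = zeta (dotr k w)) (lin j)).
exists (\sum_j zdelta (th_tors_of (w j)) *+ Num.trunc '[psi, 'chi_j]).
  by apply: zN_sum => j _; apply/zN_muln/zN_delta.
move=> th thP; rewrite mu_vecE // -psiE zchar_sum [in RHS](cfun_sum_cfdot psi) sum_cfunE.
apply: eq_bigr => j _; rewrite zcharMn zchar_delta dual_vec_tors // cfunE wE.
by rewrite -[in RHS](truncnK (Cnat_cfdot_char_irr j psiC)) mulr_natl.
Qed.

Lemma kappa_exists : exists f, is_kappa mu f /\ OmegaCh f.
Proof.
exists (pt_hom mu); split.
  by apply: pt_hom_kappa => //; exact: mu_irr.
by apply: pt_hom_Omega => //; [exact: mu_irr | move=> k th; apply: mu_nat].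
Qed.
End OneMu.
End Kappa.

Section KappaImage.
Variables (n p d : nat) (A : 'M['F_p]_(d.*2)).
Hypotheses (p_pr : prime p) (p_odd : odd p).
Hypothesis alt : forall u, bform A u u = 0.
Hypothesis ndeg : A \in unitmx.
Local Notation gT := (heis_of A).
Local Notation G := [set: heis_of A].
Local Notation Th := (Theta n p).
Local Notation ZT := (ZTh n p).
Local Notation Vs := (@Vstar p d A).
Local Notation phi := (phi_zeta A).

Lemma additive_mx m1 m2 (h : 'rV['F_p]_m1 -> 'rV['F_p]_m2) :
  (forall k l, h (k + l) = h k + h l) -> exists W, forall k, h k = k *m W.
Proof.
move=> hD; have h0 : h 0 = 0.
  by apply: (addrI (h 0)); rewrite -hD !addr0.
have hMn k j : h (k *+ j) = h k *+ j.
  by elim: j => [|j IH]; rewrite ?mulr0n // !mulrS hD IH.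
exists (\matrix_i h (delta_mx 0 i)) => k.
rewrite {1}[k]row_sum_delta mulmx_sum_row (big_morph h hD h0).
by apply: eq_bigr => i _; rewrite rowK -{1}[k 0 i]natr_Zp scaler_nat hMn -scaler_nat natr_Zp.
Qed.

Lemma dotr_factor m1 m2 (W : 'M['F_p]_(m1, m2)) (z : 'rV['F_p]_m1) :
  (forall k, k *m W = 0 -> dotr k z = 0) -> exists y, forall k, dotr k z = dotr (k *m W) y.
Proof.
move=> h; have /submxP[y yE] : (z <= W^T)%MS.
  rewrite submxE; apply/eqP/rowP => j; set C := cokermx _.
  have kW : (col j C)^T *m W = 0.
    by rewrite -[X in _ *m X]trmxK -trmx_mul colE mulmxA mulmx_coker mul0mx trmx0.
  by have := h _ kW; rewrite dotrC /dotr trmxK colE mulmxA -colE !mxE.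
by exists y => k; rewrite yE /dotr !trmx_mul trmxK mulmxA.
Qed.

Lemma pt_eq (mu mu' : (Th -> QZp p) -> gT) (f f' : 'CF(G) -> ZT) th x :
  is_kappa mu f -> is_kappa mu' f' -> {in 'Z[irr G]%g, f =1 f'} -> is_dual th ->
  x \in 'Z[irr G]%g -> x (mu th) = x (mu' th).
Proof. by move=> fk fk' ff' thP xZ; rewrite -fk // ff' // fk'. Qed.

Lemma kappa_inj (mu mu' : (Th -> QZp p) -> gT) (f f' : 'CF(G) -> ZT) :
  hom_dual mu -> hom_dual mu' -> is_kappa mu f -> is_kappa mu' f' ->
  {in 'Z[irr G]%g, f =1 f'} -> conj_hom mu mu'.
Proof.
move=> mu_hom mu_hom' fk fk' ff'.
have eqx k x : x \in 'Z[irr G]%g -> x (mu_vec mu k) = x (mu_vec mu' k).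
  by move=> xZ; apply: (pt_eq fk fk' ff') => //; apply: is_dual_comb.
have mD := mu_vecD p_pr p_odd alt mu_hom; have mD' := mu_vecD p_pr p_odd alt mu_hom'.
have e2 k : (mu_vec mu' k).2 = (mu_vec mu k).2.
  apply: dotr_eq => w; apply: (zeta_inj p_pr p_odd).
  by rewrite ![dotr w _]dotrC -!(lamE p_pr p_odd) eqx ?irr_vchar.
have [|W WE] := @additive_mx _ _ (fun k => (mu_vec mu k).2).
  by move=> k l; rewrite mD.
have [|z zE] := @additive_mx n 1 (fun k => const_mx ((mu_vec mu' k).1 - (mu_vec mu k).1)).
  move=> k l; apply/rowP => j; rewrite !mxE mD mD' !heis_mulE /= !e2; ring.
have zD k : (mu_vec mu' k).1 - (mu_vec mu k).1 = dotr k z^T.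
  by have /rowP/(_ 0) := zE k; rewrite /dotr trmxK !mxE.
have [|y yE] := @dotr_factor _ _ W z^T.
  move=> k kW; rewrite -zD; have m2 : (mu_vec mu k).2 = 0 by rewrite WE.
  have := eqx k phi (phi_vchar p_pr p_odd alt ndeg); rewrite !phi_zetaE e2 m2 eqxx.
  by move/(mulfI (pd_neq0 d p_pr))/(zeta_inj p_pr p_odd) => ->; rewrite subrr.
have [w wE] := bform_repr ndeg (2%:R^-1 *: y).
exists ((0, w) : gT) => th thP; rewrite !(mu_vecE p_pr p_odd alt) //.
set k := dual_vec th; rewrite (heis_conjgE alt) /= wE.
rewrite [mu_vec mu' k]surjective_pairing e2; congr (_, _).
rewrite -[LHS](subrK (mu_vec mu k).1) zD yE addrC -WE; congr (_ + _).
by rewrite dotrC [in RHS]dotrC dotrZl -[RHS]mulr_natl mulVKf ?two_neq0.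
Qed.

Lemma kappa_image (alpha : Iirr G -> Th) (u : ZT) : in_U alpha u ->
  (exists (mu : (Th -> QZp p) -> gT) (f : 'CF(G) -> ZT),
     [/\ hom_dual mu, is_kappa mu f & restr f alpha u]) <-> img_dual_isotropic alpha.
Proof.
move=> U; split=> [[mu [f [mu_hom fk [fa fu]]]] v w [th [thP vP]] [th' [thP' wP]]|iso].
  have mu2 th0 v0 : is_dual th0 ->
      (forall i, i \in Vs -> 'chi_i (heis_lift A v0) = qzexp (th0 (alpha i))) -> (mu th0).2 = v0.
    move=> thP0 vP0; apply: (@heis_lift_inj p d A p_pr p_odd) => i iV.
    rewrite vP0 // -(zchar_delta (alpha i)) -fa // fk ?irr_vchar //.
    by case/(VstarP p_pr p_odd): iV => y ->; rewrite !lamE.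
  have := mu_hom _ _ thP thP'; rewrite (dual_addC p_pr p_odd) mu_hom // !heis_mulE.
  rewrite (mu2 th v) // (mu2 th' w) // => /(congr1 fst)/eqP /=.
  rewrite (bform_asym alt w) [(mu th').1 + _]addrC (inj_eq (addrI _)) => /eqP e.
  apply/eqP; rewrite -[_ == 0]orFb -(negPf (two_neq0 p_pr p_odd)) -mulf_eq0.
  by rewrite mulr_natl mulr2n -{1}e addNr.
have mu_hom := U_pt_hom p_pr p_odd U iso.
have [f [fk fO]] := kappa_exists p_pr p_odd alt mu_hom.
exists (U_pt alpha u), f; split=> //; split=> [i iV|].
  apply: zchar_inj => // th thP; rewrite fk ?irr_vchar //.
  by rewrite (U_pt_Vs p_pr p_odd U iV).
apply: zchar_inj => // th thP; rewrite fk ?phi_vchar //.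
exact: U_pt_phi.
Qed.
End KappaImage.

Unset Implicit Arguments.

(* G = heis_of A (with underlying set [set: heis_of A]), V = 'rV['F_p]_(d.*2), *)
(* b = bform A, Theta = Theta n p, Z[Theta] = ZTh n p.  See Defs.v.            *)
Theorem theorem15p6 (p d n : nat) (A : 'M['F_p]_(d.*2)) :
  prime p -> odd p -> (0 < d)%N -> (0 < n)%N ->
  (* b is alternating and nondegenerate *)
  (forall u, bform A u u = 0) -> A \in unitmx ->
  [/\
   (* BIJECTION: f |-> (f|_{V^*}, f(phi(zeta))) maps Omega_Ch(G) into U ... *)
   (forall f : 'CF([set: heis_of A]) -> ZTh n p,
      OmegaCh f -> exists (alpha : Iirr [set: heis_of A] -> Theta n p) (u : ZTh n p), restr f alpha u /\ in_U alpha u),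
   (* ... injectively ... *)
   (forall (f g : 'CF([set: heis_of A]) -> ZTh n p)
      (alpha : Iirr [set: heis_of A] -> Theta n p) (u : ZTh n p),
      OmegaCh f -> OmegaCh g -> restr f alpha u -> restr g alpha u ->
      {in 'Z[irr [set: heis_of A]]%g, f =1 g}) &
   (* ... and onto U; *)
   (forall (alpha : Iirr [set: heis_of A] -> Theta n p) (u : ZTh n p), in_U alpha u ->
      exists f, OmegaCh f /\ restr f alpha u)] /\
  [/\
   (* kappa : Omega(G) -> Omega_Ch(G), [mu] |-> mu^*, is well defined ... *)
   (forall mu : (Theta n p -> QZp p) -> heis_of A, hom_dual mu -> exists f, is_kappa mu f /\ OmegaCh f),
   (* ... and injective; *)
   (forall (mu mu' : (Theta n p -> QZp p) -> heis_of A)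
      (f f' : 'CF([set: heis_of A]) -> ZTh n p), hom_dual mu -> hom_dual mu' ->
      is_kappa mu f -> is_kappa mu' f' ->
      {in 'Z[irr [set: heis_of A]]%g, f =1 f'} -> conj_hom mu mu') &
   (* its image corresponds to the (alpha, u) in U with im(alpha^* ) isotropic *)
   (forall (alpha : Iirr [set: heis_of A] -> Theta n p) (u : ZTh n p), in_U alpha u ->
      ((exists (mu : (Theta n p -> QZp p) -> heis_of A)
               (f : 'CF([set: heis_of A]) -> ZTh n p), [/\ hom_dual mu, is_kappa mu f & restr f alpha u]) <->
       img_dual_isotropic alpha))].
Proof.
move=> p_pr p_odd d_gt0 _ alt ndeg; split; split.
- exact: Om_to_U.
- exact: Om_inj.
- exact: U_surj.
- exact: kappa_exists.
- exact: kappa_inj.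
- exact: kappa_image.
Qed.
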